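(* Let $L,N$ be positive integers with $L+1<N$. Let $\mathbf{G}\in\mathbb{C}^{L\times N}$ be a random matrix with independent $\mathcal{CN}(0,\sigma_1^2)$ entries, let $\mathbf{x}\sim\mathcal{CN}(0,\sigma_2^2\mathbf{I}_L)$ be independent of $\mathbf{G}$, and let $\rho=\sigma_2/\sigma_1$. Then $$\mathbb{E}\big(\|\mathbf{G}^{+}\mathbf{x}\|\big)\ \le\ \sqrt{\frac{L}{N-L-1}}\,\rho,$$ where $\mathbf{G}^{+}=\mathbf{G}^H(\mathbf{G}\mathbf{G}^H)^{-1}$ is the Moore–Penrose pseudo-inverse.
   Context: $\|\cdot\|$ denotes the Euclidean norm. $\mathcal{CN}$ denotes the circularly symmetric complex Gaussian distribution; $(\cdot)^H$ is the conjugate transpose. *)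

(* Defs.v *)
From HB Require Import structures.
From mathcomp Require Import all_boot all_order all_algebra.
From mathcomp Require Import all_classical all_reals all_analysis.
From mathcomp.real_closed Require Import complex.

Set Implicit Arguments.
Unset Strict Implicit.
Unset Printing Implicit Defensive.

Import Order.TTheory GRing.Theory Num.Theory.
Local Open Scope classical_set_scope.
Local Open Scope ring_scope.

Definition ctrmx (R : rcfType) (m n : nat) (A : 'M[R[i]]_(m, n)) : 'M[R[i]]_(n, m) :=
  (map_mx (@conjc R) A)^T.

Definition moore_pinv (R : rcfType) (m n : nat) (G : 'M[R[i]]_(m, n)) : 'M[R[i]]_(n, m) :=
  ctrmx G *m invmx (G *m ctrmx G).

Definition cvnorm (R : rcfType) (n : nat) (v : 'cV[R[i]]_n) : R :=
  Num.sqrt (\sum_(k < n) ((@complex.Re R (v k ord0)) ^+ 2 + (@complex.Im R (v k ord0)) ^+ 2)).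

(* Mutual independence of a finite family of real random variables:
   product rule for every choice of Borel sets (taking B i = setT for
   unused indices gives the product rule on every subfamily). *)
Definition mutually_independent d (T : measurableType d) (R : realType)
    (P : probability T R) (I : finType) (X : I -> {RV P >-> R}) : Prop :=
  forall B : I -> set R, (forall k, measurable (B k)) ->
    P (\bigcap_(k in [set: I]) (X k @^-1` B k)) =
    (\prod_(k : I) P (X k @^-1` B k))%E.

(* Index type of the real coordinates:
   inl (i, j, false/true) = real/imaginary part of G_{ij},
   inr (i, false/true)    = real/imaginary part of x_i. *)
Definition coord_idx (L N : nat) : finType :=
  (('I_L * 'I_N * bool) + ('I_L * bool))%type.

Definition Gmat d (T : measurableType d) (R : realType) (P : probability T R)
    (L N : nat) (X : coord_idx L N -> {RV P >-> R}) (w : T) : 'M[R[i]]_(L, N) :=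
  \matrix_(i < L, j < N) Complex (X (inl (i, j, false)) w) (X (inl (i, j, true)) w).

Definition xvec d (T : measurableType d) (R : realType) (P : probability T R)
    (L N : nat) (X : coord_idx L N -> {RV P >-> R}) (w : T) : 'cV[R[i]]_L :=
  \col_(i < L) Complex (X (inr (i, false)) w) (X (inr (i, true)) w).

(* Main.v *)
(** Put [W = G G^H + e I], [V = W^-1] and [K = G^H V G] for [e > 0].  Stein's identity
    [E (Z f(Z)) = s^2 E f'(Z)], applied to every real coordinate of [G] with the entries
    of [V G] as test functions, gives
    [E (tr K) = sigma1^2 E (tr V * (N - tr K))], and [tr K <= L], so
    [sigma1^2 (N - L) E (tr V) <= L].  The same identity in the coordinates of [x] gives
    [E (x^H V x) = sigma2^2 E (tr V)].  As [e] tends to [0], [tr V] blows up where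
    [G G^H] is singular, which therefore happens with probability [0], and elsewhere
    [x^H V x] tends to [||G^+ x||^2]; Fatou's lemma bounds the second moment of
    [||G^+ x||], hence its first one. *)

Require Import Defs.
From HB Require Import structures.
From mathcomp Require Import all_boot all_order perm all_algebra.
From mathcomp Require Import all_classical all_reals all_analysis measurable_realfun.
From mathcomp.real_closed Require Import complex.
From mathcomp Require Import ring lra.
Import Order.TTheory GRing.Theory Num.Theory.
Import numFieldNormedType.Exports.
Local Open Scope classical_set_scope.
Local Open Scope ring_scope.

Set Implicit Arguments.
Unset Strict Implicit.
Unset Printing Implicit Defensive.

(** * Regularized Gram matrices *)

(** At [e = 0] the entries of [V G] are unbounded and the integrability of inverse moments is
    exactly what is unknown, so Stein's identity cannot be applied there. For [e > 0] the matrix [W]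
    is invertible for every [G], all test functions are differentiable everywhere, and their size is
    controlled by powers of [1/e]; the resulting bound on [E (tr V)] does not involve [e]. No
    density of a Wishart matrix or of its eigenvalues is used.

    Differentiating an entry of [V G] also produces the square of that entry. In the complex case
    these squares cancel between the real and the imaginary coordinate, which leaves the denominator
    [N - L]; it is weakened to [N - L - 1] only at the very end.

    Each real coordinate has half the variance of its complex entry, and the factor 2 coming from
    the two parts compensates for this.

    Independence is given as a product rule for the whole family. To use the one-dimensional
    identity in one coordinate, the law of that coordinate together with the others is shown to be a
    product measure, and Fubini's theorem applies. *)

Definition nsq (R : rcfType) (z : R[i]) : R :=
  (complex.Re z) ^+ 2 + (complex.Im z) ^+ 2.

Lemma ler_sum_term (R : numDomainType) (I : finType) (F : I -> R) k :
  (forall i, 0 <= F i) -> F k <= \sum_i F i.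
Proof. by move=> F0; rewrite (bigD1 k) //= lerDl sumr_ge0. Qed.

Lemma sqr_sum_le (R : realFieldType) n (F : 'I_n -> R) :
  (\sum_i F i) ^+ 2 <= n%:R * \sum_i F i ^+ 2.
Proof.
rewrite expr2 mulr_suml.
(* With both sides written as double sums, the claim holds term by term: [F i * F j] is at most the
   mean of the two squares. *)
have -> : n%:R * \sum_i F i ^+ 2 = \sum_(i < n) \sum_(j < n) ((F i ^+ 2 + F j ^+ 2) / 2).
  apply/esym; under eq_bigr do rewrite -mulr_suml big_split /= sumr_const card_ord.
  rewrite -mulr_suml big_split /= sumr_const card_ord sumrMnl mulr_natl.
  by move: (_ *+ n) => t; field.
rewrite ler_sum // => i _; rewrite mulr_sumr ler_sum // => j _.
by have := sqr_ge0 (F i - F j); nra.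
Qed.

Section Nsq.
Variable R : rcfType.
Implicit Types (z w : R[i]).

Lemma nsq_ge0 z : 0 <= nsq z.
Proof. by rewrite addr_ge0 ?sqr_ge0. Qed.

Lemma nsq_eq0 z : nsq z = 0 -> z = 0.
Proof.
case: z => a b /eqP; rewrite /nsq /= paddr_eq0 ?sqr_ge0 // !sqrf_eq0.
by case/andP=> /eqP -> /eqP ->.
Qed.

Lemma nsq_real (r : R) : nsq (real_complex R r) = r ^+ 2.
Proof. by rewrite /nsq /=; ring. Qed.

Lemma sqr_Re_le_nsq z : (complex.Re z) ^+ 2 <= nsq z.
Proof. by rewrite /nsq lerDl sqr_ge0. Qed.

Lemma sqr_Im_le_nsq z : (complex.Im z) ^+ 2 <= nsq z.
Proof. by rewrite /nsq lerDr sqr_ge0. Qed.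

Lemma Re_add z w : complex.Re (z + w) = complex.Re z + complex.Re w.
Proof. by case: z w => [a b] [c d]. Qed.

Lemma Im_add z w : complex.Im (z + w) = complex.Im z + complex.Im w.
Proof. by case: z w => [a b] [c d]. Qed.

Lemma Re_opp z : complex.Re (- z) = - complex.Re z.
Proof. by case: z. Qed.

Lemma Im_opp z : complex.Im (- z) = - complex.Im z.
Proof. by case: z. Qed.

Lemma Re_mul z w : complex.Re (z * w) =
  complex.Re z * complex.Re w - complex.Im z * complex.Im w.
Proof. by case: z w => [a b] [c d]. Qed.

Lemma Im_mul z w : complex.Im (z * w) =
  complex.Re z * complex.Im w + complex.Im z * complex.Re w.
Proof. by case: z w => [a b] [c d]; simpc. Qed.

Lemma Re_sum (I : Type) (r : seq I) (Q : pred I) (F : I -> R[i]) :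
  complex.Re (\sum_(i <- r | Q i) F i) = \sum_(i <- r | Q i) complex.Re (F i).
Proof. exact: (big_morph (@complex.Re R) Re_add). Qed.

Lemma Im_sum (I : Type) (r : seq I) (Q : pred I) (F : I -> R[i]) :
  complex.Im (\sum_(i <- r | Q i) F i) = \sum_(i <- r | Q i) complex.Im (F i).
Proof. exact: (big_morph (@complex.Im R) Im_add). Qed.

Lemma eq_ReIm z w : complex.Re z = complex.Re w -> complex.Im z = complex.Im w -> z = w.
Proof. by case: z w => [a b] [c d] /= -> ->. Qed.

Lemma mul_conjc z : z * conjc z = (real_complex R) (nsq z).
Proof.
by apply: eq_ReIm; rewrite ?Re_mul ?Im_mul /nsq; case: z => a b /=; ring.
Qed.

Lemma nsqM z w : nsq (z * w) = nsq z * nsq w.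
Proof. by rewrite /nsq Re_mul Im_mul; ring. Qed.

Lemma nsq_sum_le n (F : 'I_n -> R[i]) :
  nsq (\sum_i F i) <= n%:R * \sum_i nsq (F i).
Proof.
by rewrite /nsq Re_sum Im_sum big_split mulrDr lerD ?sqr_sum_le.
Qed.

End Nsq.

Section Ctrmx.
Variable R : rcfType.
Local Notation C := R[i].

Lemma ctrmxE m n (A : 'M[C]_(m, n)) i j : ctrmx A i j = conjc (A j i).
Proof. by rewrite /ctrmx !mxE. Qed.

Lemma ctrmxM m n p (A : 'M[C]_(m, n)) (B : 'M[C]_(n, p)) :
  ctrmx (A *m B) = ctrmx B *m ctrmx A.
Proof. by rewrite /ctrmx map_mxM trmx_mul. Qed.

Lemma ctrmxK m n (A : 'M[C]_(m, n)) : ctrmx (ctrmx A) = A.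
Proof. by apply/matrixP => i j; rewrite !ctrmxE conjcK. Qed.

Lemma ctrmxD m n (A B : 'M[C]_(m, n)) : ctrmx (A + B) = ctrmx A + ctrmx B.
Proof. by rewrite /ctrmx map_mxD linearD. Qed.

Lemma ctrmx_scalar n (r : R) : ctrmx ((real_complex R r)%:M : 'M[C]_n) = (real_complex R r)%:M.
Proof. by rewrite /ctrmx map_scalar_mx tr_scalar_mx /= oppr0. Qed.

Lemma mulmx_ctrmx_diag m n (A : 'M[C]_(m, n)) i :
  (A *m ctrmx A) i i = real_complex R (\sum_j nsq (A i j)).
Proof.
rewrite !mxE rmorph_sum; apply: eq_bigr => j _.
by rewrite ctrmxE mul_conjc.
Qed.

Lemma ctrmx_mulmx_diag m n (A : 'M[C]_(m, n)) j :
  (ctrmx A *m A) j j = real_complex R (\sum_i nsq (A i j)).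
Proof.
rewrite !mxE rmorph_sum; apply: eq_bigr => i _.
by rewrite ctrmxE mulrC mul_conjc.
Qed.

End Ctrmx.

Definition reg_gram (R : rcfType) (m n : nat) (e : R) (G : 'M[R[i]]_(m, n)) : 'M[R[i]]_m :=
  G *m ctrmx G + (real_complex R e)%:M.

Definition resolvent (R : rcfType) (m n : nat) (e : R) (G : 'M[R[i]]_(m, n)) : 'M[R[i]]_m :=
  invmx (reg_gram e G).

Section Resolvent.
Variables (R : rcfType) (m n : nat) (e : R) (G : 'M[R[i]]_(m, n)).
Hypothesis e_gt0 : 0 < e.
Local Notation C := R[i].
Local Notation W := (reg_gram e G).
Local Notation V := (resolvent e G).
Local Notation p := (V *m G).
Local Notation K := (ctrmx G *m (V *m G)).

(** If [u W = 0] then [0 = u W u^H = ||u G||^2 + e ||u||^2], a sum of nonnegative terms, and [e > 0]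
    forces [u = 0]. *)
Lemma reg_gram_unit : W \in unitmx.
Proof.
rewrite -row_free_unit -kermx_eq0; apply/rowV0P => u /sub_kermxP uW0.
have : (u *m W *m ctrmx u) 0 0 = 0 by rewrite uW0 mul0mx mxE.
rewrite mulmxDr mulmxDl mulmxA -mulmxA -ctrmxM mxE mulmx_ctrmx_diag.
rewrite mul_mx_scalar -scalemxAl mxE mulmx_ctrmx_diag -rmorphM -rmorphD.
move/complexI => /eqP.
rewrite paddr_eq0 ?mulr_ge0 ?sumr_ge0 ?(ltW e_gt0) // => [|j _|j _]; try exact: nsq_ge0.
rewrite mulf_eq0 (gt_eqF e_gt0) /= => /andP[_ /eqP /psumr_eq0P u0].
apply/rowP => j; rewrite mxE; apply: nsq_eq0; apply: u0 => // k _; exact: nsq_ge0.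
Qed.

Lemma ctrmx_reg_gram : ctrmx W = W.
Proof. by rewrite /reg_gram ctrmxD ctrmxM ctrmxK ctrmx_scalar. Qed.

Lemma resolvent_mull : V *m W = 1%:M.
Proof. exact: mulVmx reg_gram_unit. Qed.

Lemma resolvent_mulr : W *m V = 1%:M.
Proof. exact: mulmxV reg_gram_unit. Qed.

Lemma ctrmx_resolvent : ctrmx V = V.
Proof.
rewrite -[LHS](mulmx1) -resolvent_mulr mulmxA -{1}ctrmx_reg_gram -ctrmxM resolvent_mulr.
by rewrite ctrmx_scalar mul1mx.
Qed.

(** This is [V = V W V^H] with [W] expanded. It exhibits [V] as a sum of two Gram matrices, from
    which the positivity of [V] and the bounds on its entries and on those of [p] are read off. *)
Lemma resolvent_gram : V = p *m ctrmx p + real_complex R e *: (V *m ctrmx V).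
Proof.
rewrite -[LHS](mulmx1) -resolvent_mulr mulmxA mulmxDr mulmxDl ctrmxM ctrmx_resolvent.
by rewrite mul_mx_scalar -scalemxAl !mulmxA.
Qed.

(** The diagonal entry [V i i] as an element of [R]. Written as a sum of squares it is real and
    nonnegative by construction, and each of its terms is bounded by the whole. *)
Definition resolvent_diag (i : 'I_m) : R :=
  \sum_j nsq (p i j) + e * \sum_k nsq (V i k).

Lemma resolvent_diagE i : V i i = real_complex R (resolvent_diag i).
Proof.
by rewrite {1}resolvent_gram mxE mulmx_ctrmx_diag mxE mulmx_ctrmx_diag -rmorphM -rmorphD.
Qed.

Lemma resolvent_diag_ge0 i : 0 <= resolvent_diag i.
Proof.
by rewrite addr_ge0 ?mulr_ge0 ?sumr_ge0 ?(ltW e_gt0) // => j _; exact: nsq_ge0.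
Qed.

Lemma nsq_resolvent_le_diag i k : e * nsq (V i k) <= resolvent_diag i.
Proof.
apply: (@le_trans _ _ (e * \sum_k nsq (V i k))).
  rewrite ler_pM2l //; apply: (ler_sum_term (F := fun k => nsq (V i k))) => j.
  exact: nsq_ge0.
by rewrite lerDr sumr_ge0 // => j _; exact: nsq_ge0.
Qed.

Lemma nsq_resolventG_le_diag i j : nsq (p i j) <= resolvent_diag i.
Proof.
apply: (@le_trans _ _ (\sum_j nsq (p i j))).
  apply: (ler_sum_term (F := fun j => nsq (p i j))) => k; exact: nsq_ge0.
by rewrite lerDl mulr_ge0 ?sumr_ge0 ?(ltW e_gt0) // => k _; exact: nsq_ge0.
Qed.

(** For [d] the diagonal entry, the bound on [nsq (V i k)] at [k = i] reads [e d^2 <= d]. *)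
Lemma resolvent_diag_le i : resolvent_diag i <= e^-1.
Proof.
have := nsq_resolvent_le_diag i i.
rewrite resolvent_diagE nsq_real expr2 mulrA.
have := resolvent_diag_ge0 i; rewrite le_eqVlt => /orP[/eqP <- _|d0].
  by rewrite invr_ge0 ltW.
by rewrite ger_pMl // -ler_pdivlMl // mulr1.
Qed.

Lemma nsq_resolventG_le i j : nsq (p i j) <= e^-1.
Proof. exact: le_trans (nsq_resolventG_le_diag i j) (resolvent_diag_le i). Qed.

Lemma nsq_resolvent_le i k : nsq (V i k) <= e^-1 ^+ 2.
Proof.
rewrite expr2 ler_pdivlMl //.
exact: le_trans (nsq_resolvent_le_diag i k) (resolvent_diag_le i).
Qed.

(** [K] is a regularized orthogonal projection: it is Hermitian, and [K - K^2] is the positive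
    matrix [e p^H p] instead of [0]. This keeps its diagonal between 0 and 1. *)
Lemma proj_gram : K = K *m ctrmx K + real_complex R e *: (ctrmx p *m p).
Proof.
have cK : ctrmx K = K.
  by rewrite !ctrmxM ctrmxK ctrmx_resolvent mulmxA.
rewrite cK ctrmxM ctrmx_resolvent scalemxAl.
rewrite -{1}(mul1mx (V *m G)) -resolvent_mulr.
(* Both [W V] and [V W] are the identity; with [V W] in the middle, expanding [W] as [G G^H + e]
   makes the product [K K] appear. *)
have -> : ctrmx G *m (W *m V *m (V *m G)) = ctrmx G *m (V *m W *m (V *m G)).
  by rewrite resolvent_mulr resolvent_mull.
rewrite mulmxDr mulmxDl mulmxDr mul_mx_scalar.
by rewrite -!scalemxAl -!scalemxAr !mulmxA.
Qed.

Definition proj_diag (j : 'I_n) : R :=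
  \sum_k nsq (K j k) + e * \sum_i nsq (p i j).

Lemma proj_diagE j : K j j = real_complex R (proj_diag j).
Proof.
by rewrite {1}proj_gram mxE mulmx_ctrmx_diag mxE ctrmx_mulmx_diag -rmorphM -rmorphD.
Qed.

Lemma proj_diag_ge0 j : 0 <= proj_diag j.
Proof.
by rewrite addr_ge0 ?mulr_ge0 ?sumr_ge0 ?(ltW e_gt0) // => k _; exact: nsq_ge0.
Qed.

(** The square of [K j j] is one of the terms of the diagonal entry of [K K^H], which [proj_gram]
    bounds by [K j j]; thus [d^2 <= d]. *)
Lemma proj_diag_le1 j : proj_diag j <= 1.
Proof.
have : proj_diag j * proj_diag j <= proj_diag j.
  rewrite -expr2 -nsq_real -proj_diagE .
  apply: (@le_trans _ _ (\sum_k nsq (K j k))).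
    apply: (ler_sum_term (F := fun k => nsq (K j k))) => k; exact: nsq_ge0.
  by rewrite lerDl mulr_ge0 ?sumr_ge0 ?(ltW e_gt0) // => k _; exact: nsq_ge0.
have := proj_diag_ge0 j; rewrite le_eqVlt => /orP[/eqP <- _|d0]; first exact: ler01.
by rewrite ger_pMl.
Qed.

(** By cyclicity of the trace, [tr K = tr (V G G^H) = tr (V (W - e))], and [V W] is the identity. *)
Lemma sum_proj_diag : \sum_j proj_diag j = m%:R - e * \sum_i resolvent_diag i.
Proof.
apply: (@complexI R).
have -> : real_complex R (\sum_j proj_diag j) = \tr K.
  by rewrite rmorph_sum; apply: eq_bigr => j _; exact/esym/proj_diagE.
have -> : real_complex R (m%:R - e * \sum_i resolvent_diag i) =
          m%:R - real_complex R e * \tr V.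
  rewrite rmorphB rmorphM rmorph_sum rmorph_nat; congr (_ - _ * _).
  by apply: eq_bigr => j _; exact/esym/resolvent_diagE.
rewrite mxtrace_mulC -mulmxA.
have -> : G *m ctrmx G = W - (real_complex R e)%:M by rewrite /reg_gram addrK.
rewrite mulmxBr resolvent_mull mul_mx_scalar linearB linearZ /= mxtrace1.
by [].
Qed.

Lemma sum_proj_diag_le : \sum_j proj_diag j <= m%:R.
Proof.
rewrite sum_proj_diag gerBl mulr_ge0 ?(ltW e_gt0) // sumr_ge0 // => i _.
exact: resolvent_diag_ge0.
Qed.

(* An eigenvector [u] of the Gram matrix for the eigenvalue [0] is fixed by [e V];
   compare entries at the index where [u] is largest. *)
Lemma resolvent_diag_singular : G *m ctrmx G \notin unitmx ->
  e^-1 <= m%:R * \sum_i resolvent_diag i.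
Proof.
rewrite -row_free_unit -kermx_eq0 => /rowV0Pn[u /sub_kermxP uS u0].
have uE : u = real_complex R e *: (u *m V).
  rewrite -{1}(mulmx1 u) -resolvent_mulr mulmxA mulmxDr uS add0r mul_mx_scalar.
  by rewrite scalemxAl.
have [k uk0] : exists k, u 0 k != 0.
  by apply/rV0Pn.
pose i := [arg max_(i > k) nsq (u 0 i)]%O.
have imax j : nsq (u 0 j) <= nsq (u 0 i).
  by rewrite /i; case: arg_maxP => // i' _; apply.
have ui0 : 0 < nsq (u 0 i).
  rewrite lt_neqAle nsq_ge0 andbT; apply/eqP => ui0.
  have := imax k; rewrite -ui0 => uk.
  by move/eqP: uk0; apply; apply: nsq_eq0; apply/eqP; rewrite eq_le uk nsq_ge0.
have : nsq (u 0 i) <= e ^+ 2 * (m%:R * \sum_j nsq (u 0 i) * nsq (V i j)).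
  rewrite {1}uE mxE nsqM nsq_real ler_wpM2l ?sqr_ge0 // mxE.
  apply: le_trans (nsq_sum_le _) _; rewrite ler_wpM2l // ler_sum // => j _.
  rewrite nsqM ler_pM ?nsq_ge0 //.
  by rewrite -{1}ctrmx_resolvent ctrmxE /nsq; case: (V i j) => a b /=; rewrite sqrrN.
rewrite -mulr_sumr; set s := \sum_j _ => H.
have es : e * s <= \sum_i resolvent_diag i.
  apply: (@le_trans _ _ (resolvent_diag i)).
    by rewrite lerDr sumr_ge0 // => j _; exact: nsq_ge0.
  by apply: ler_sum_term => j; exact: resolvent_diag_ge0.
have : nsq (u 0 i) * 1 <= nsq (u 0 i) * (e * (m%:R * \sum_i resolvent_diag i)).
  rewrite mulr1; apply: le_trans H _.
  have -> : e ^+ 2 * (m%:R * (nsq (u 0 i) * s)) = nsq (u 0 i) * (e * (m%:R * (e * s))).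
    by ring.
  by rewrite ler_pM2l // ler_pM2l // ler_wpM2l.
by rewrite ler_pM2l // -ler_pdivrMl // mulr1.
Qed.

(** By [resolvent_gram] the form equals [||p^H x||^2 + e ||V^H x||^2]. *)
Lemma quad_resolvent_ge0 (x : 'cV[C]_m) : 0 <= complex.Re ((ctrmx x *m (V *m x)) 0 0).
Proof.
rewrite resolvent_gram mulmxDl mulmxDr mxE Re_add.
have -> : ctrmx x *m (p *m ctrmx p *m x) = ctrmx (ctrmx p *m x) *m (ctrmx p *m x).
  by rewrite [ctrmx (ctrmx p *m x)]ctrmxM ctrmxK !mulmxA.
have -> : ctrmx x *m (real_complex R e *: (V *m ctrmx V) *m x) =
    real_complex R e *: (ctrmx (ctrmx V *m x) *m (ctrmx V *m x)).
  by rewrite [ctrmx (ctrmx V *m x)]ctrmxM ctrmxK -scalemxAl -scalemxAr !mulmxA.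
rewrite ctrmx_mulmx_diag [X in _ + complex.Re X]mxE ctrmx_mulmx_diag -rmorphM /=.
by rewrite addr_ge0 ?mulr_ge0 ?sumr_ge0 ?(ltW e_gt0) // => k _; exact: nsq_ge0.
Qed.

Lemma sqr_cvnorm (k : nat) (z : 'cV[C]_k) : cvnorm z ^+ 2 = complex.Re ((ctrmx z *m z) 0 0).
Proof.
rewrite ctrmx_mulmx_diag /= sqr_sqrtr // sumr_ge0 // => i _; exact: nsq_ge0.
Qed.

(** Put [S = G G^H] and [x = S y]. Then [||G^+ x||^2 = y^H S y], whereas [x^H V x = y^H S V S y],
    and these differ by terms of order [e]. The error term on the right is [e ||y||^2] with [y]
    independent of [e], so it vanishes in the limit. *)
Lemma sqr_pinv_le (x : 'cV[C]_m) : G *m ctrmx G \in unitmx ->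
  cvnorm (moore_pinv G *m x) ^+ 2 <=
  complex.Re ((ctrmx x *m (V *m x)) 0 0) +
  e * cvnorm (invmx (G *m ctrmx G) *m x) ^+ 2.
Proof.
move=> uS; rewrite /moore_pinv -mulmxA; set S := G *m ctrmx G in uS *.
set y := invmx S *m x.
have -> : x = S *m y by rewrite mulKVmx.
clearbody y.
have cS : ctrmx S = S by rewrite ctrmxM ctrmxK.
have SW : S = W - (real_complex R e)%:M by rewrite /reg_gram addrK.
(* [S V S = (W - e) V (W - e) = W - 2 e + e^2 V = S - e + e^2 V]. The last term is nonnegative and
   is dropped at the end. *)
have -> : ctrmx (S *m y) *m (V *m (S *m y)) = ctrmx y *m (S *m y)
    - real_complex R e *: (ctrmx y *m y)
    + real_complex R (e ^+ 2) *: (ctrmx y *m (V *m y)).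
  rewrite ctrmxM cS -mulmxA (mulmxA V S) {2}SW mulmxBr resolvent_mull mul_mx_scalar.
  rewrite mulmxBl mul1mx mulmxBr.
  rewrite (_ : S *m (real_complex R e *: V *m y) =
     real_complex R e *: y - real_complex R (e ^+ 2) *: (V *m y)); last first.
    rewrite -scalemxAl -scalemxAr mulmxA SW mulmxBl resolvent_mulr mul_scalar_mx.
    by rewrite mulmxBl mul1mx scalerBr -scalemxAl scalerA rmorphXn.
  rewrite !mulmxBr -!scalemxAr opprB addrA addrAC.
  by [].
rewrite !sqr_cvnorm ctrmxM ctrmxK -!mulmxA (mulmxA G) -/S.
have := quad_resolvent_ge0 y; move: (ctrmx y *m _) (ctrmx y *m _) (ctrmx y *m _) => A B D D0.
rewrite 5!mxE !Re_add Re_opp !Re_mul /= !mul0r !subr0.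
by rewrite addrAC subrK lerDl mulr_ge0 ?sqr_ge0.
Qed.

End Resolvent.

(** * Derivatives of complex matrix functions of a real variable *)

Section ComplexDerivative.
Variable R : realType.
Local Notation C := R[i].
Implicit Types (f g : R -> C) (t : R).

(** The variable is real and the two components are differentiated separately; no holomorphy is
    involved, so conjugation and conjugate transposition are differentiable as well. *)
Definition is_cderive f t (df : C) : Prop :=
  is_derive t 1 (fun s => complex.Re (f s)) (complex.Re df) /\
  is_derive t 1 (fun s => complex.Im (f s)) (complex.Im df).

Definition cderive f t : C :=
  Complex ('D_1 (fun s => complex.Re (f s)) t) ('D_1 (fun s => complex.Im (f s)) t).

Lemma is_cderiveE f t df : is_cderive f t df -> cderive f t = df.
Proof. by case=> d1 d2; apply: eq_ReIm => /=; exact: derive_val. Qed.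

Lemma ex_cderiveP f t : (exists df, is_cderive f t df) -> is_cderive f t (cderive f t).
Proof. by case=> df H; rewrite (is_cderiveE H). Qed.

Lemma is_cderive_unique f t d1 d2 : is_cderive f t d1 -> is_cderive f t d2 -> d1 = d2.
Proof. by move=> /is_cderiveE <- /is_cderiveE <-. Qed.

Lemma is_cderive_cst c t : is_cderive (fun=> c) t 0.
Proof. by split; exact: is_derive_cst. Qed.

Lemma is_cderiveD f g t df dg : is_cderive f t df -> is_cderive g t dg ->
  is_cderive (fun s => f s + g s) t (df + dg).
Proof.
move=> [f1 f2] [g1 g2]; split.
- under eq_fun do rewrite Re_add; rewrite Re_add; exact: is_deriveD.
- under eq_fun do rewrite Im_add; rewrite Im_add; exact: is_deriveD.
Qed.

Lemma is_cderiveM f g t df dg : is_cderive f t df -> is_cderive g t dg ->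
  is_cderive (fun s => f s * g s) t (df * g t + f t * dg).
Proof.
move=> [f1 f2] [g1 g2]; split.
- under eq_fun do rewrite Re_mul.
  refine (is_derive_eq (is_deriveB (is_deriveM f1 g1) (is_deriveM f2 g2)) _).
  by rewrite Re_add !Re_mul /GRing.scale /=; ring.
- under eq_fun do rewrite Im_mul.
  refine (is_derive_eq (is_deriveD (is_deriveM f1 g2) (is_deriveM f2 g1)) _).
  by rewrite Im_add !Im_mul /GRing.scale /=; ring.
Qed.

Lemma is_cderive_conj f t df : is_cderive f t df ->
  is_cderive (fun s => conjc (f s)) t (conjc df).
Proof.
move=> [f1 f2]; split.
- rewrite (_ : (fun _ => _) = (fun s => complex.Re (f s))); first by case: df f1 f2.
  by apply/funext => s; case: (f s).
- rewrite (_ : (fun _ => _) = (- (fun s => complex.Im (f s)))); last first.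
    by apply/funext => s /=; rewrite fctE; case: (f s).
  by rewrite (_ : complex.Im _ = - complex.Im df); [exact: is_deriveN|case: df f1 f2].
Qed.

Lemma ex_cderive_sum (I : Type) (r : seq I) (Q : pred I) (F : I -> R -> C) t :
  (forall i, exists d, is_cderive (F i) t d) ->
  exists d, is_cderive (fun s => \sum_(i <- r | Q i) F i s) t d.
Proof.
move=> H; elim: r => [|i r [d Hd]].
  by exists 0; under eq_fun do rewrite big_nil; exact: is_cderive_cst.
case Qi : (Q i); last by exists d; under eq_fun do rewrite big_cons Qi.
have [di Hi] := H i; exists (di + d); under eq_fun do rewrite big_cons Qi.
exact: is_cderiveD.
Qed.

Lemma ex_cderive_prod (I : Type) (r : seq I) (Q : pred I) (F : I -> R -> C) t :
  (forall i, exists d, is_cderive (F i) t d) ->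
  exists d, is_cderive (fun s => \prod_(i <- r | Q i) F i s) t d.
Proof.
move=> H; elim: r => [|i r [d Hd]].
  by exists 0; under eq_fun do rewrite big_nil; exact: is_cderive_cst.
case Qi : (Q i); last by exists d; under eq_fun do rewrite big_cons Qi.
have [di Hi] := H i; eexists; under eq_fun do rewrite big_cons Qi.
exact: is_cderiveM Hi Hd.
Qed.

Lemma is_cderive_sum (I : Type) (r : seq I) (F : I -> R -> C) (dF : I -> C) t :
  (forall i, is_cderive (F i) t (dF i)) ->
  is_cderive (fun s => \sum_(i <- r) F i s) t (\sum_(i <- r) dF i).
Proof.
move=> H; elim: r => [|i r IH].
  by under eq_fun do rewrite big_nil; rewrite big_nil; exact: is_cderive_cst.
by under eq_fun do rewrite big_cons; rewrite big_cons; exact: is_cderiveD.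
Qed.

Lemma inv_complexE (z : C) : z^-1 =
  Complex (complex.Re z * (nsq z)^-1) (- (complex.Im z * (nsq z)^-1)).
Proof. by case: z. Qed.

Lemma ex_cderiveV f t : f t != 0 -> (exists d, is_cderive f t d) ->
  exists d, is_cderive (fun s => (f s)^-1) t d.
Proof.
move=> ft0 [df [f1 f2]].
have n0 : nsq (f t) != 0 by apply: contra_neq ft0 => /nsq_eq0.
pose u s := complex.Re (f s); pose v s := complex.Im (f s).
have du : derivable u t 1 by exact: (@ex_derive _ _ _ _ _ _ _ f1).
have dv : derivable v t 1 by exact: (@ex_derive _ _ _ _ _ _ _ f2).
have dn : derivable (fun s => nsq (f s)) t 1.
  have -> : (fun s => nsq (f s)) = u * u + v * v.
    by apply/funext => s; rewrite /nsq !expr2.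
  exact: derivableD (derivableM du du) (derivableM dv dv).
have dw : derivable (fun s => (nsq (f s))^-1) t 1.
  by apply: (@derivableV R R (fun s => nsq (f s)) t 1 n0 dn).
exists (cderive (fun s => (f s)^-1) t); split; apply: derivableP.
- have -> : (fun s => complex.Re (f s)^-1) = u * (fun s => (nsq (f s))^-1).
    by apply/funext => s; rewrite inv_complexE.
  exact: derivableM du dw.
- have -> : (fun s => complex.Im (f s)^-1) = - (v * (fun s => (nsq (f s))^-1)).
    by apply/funext => s; rewrite inv_complexE.
  exact: derivableN (derivableM dv dw).
Qed.

End ComplexDerivative.

Section MatrixDerivative.
Variable R : realType.
Local Notation C := R[i].

Definition is_mxderive m n (A : R -> 'M[C]_(m, n)) (t : R) (dA : 'M[C]_(m, n)) : Prop :=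
  forall i j, is_cderive (fun s => A s i j) t (dA i j).

Lemma is_mxderive_unique m n (A : R -> 'M[C]_(m, n)) t d1 d2 :
  is_mxderive A t d1 -> is_mxderive A t d2 -> d1 = d2.
Proof. by move=> H1 H2; apply/matrixP => i j; exact: is_cderive_unique (H1 i j) (H2 i j). Qed.

Lemma is_mxderive_cst m n (A : 'M[C]_(m, n)) t : is_mxderive (fun=> A) t 0.
Proof. by move=> i j; rewrite mxE; exact: is_cderive_cst. Qed.

Lemma is_mxderiveD m n (A B : R -> 'M[C]_(m, n)) t dA dB :
  is_mxderive A t dA -> is_mxderive B t dB ->
  is_mxderive (fun s => A s + B s) t (dA + dB).
Proof.
move=> HA HB i j; rewrite mxE; under eq_fun do rewrite mxE.
exact: is_cderiveD.
Qed.

Lemma is_mxderiveM m n k (A : R -> 'M[C]_(m, n)) (B : R -> 'M[C]_(n, k)) t dA dB :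
  is_mxderive A t dA -> is_mxderive B t dB ->
  is_mxderive (fun s => A s *m B s) t (dA *m B t + A t *m dB).
Proof.
move=> HA HB i j; rewrite !mxE -big_split; under eq_fun do rewrite mxE.
by apply: is_cderive_sum => l; exact: is_cderiveM.
Qed.

Lemma is_mxderive_ctrmx m n (A : R -> 'M[C]_(m, n)) t dA :
  is_mxderive A t dA -> is_mxderive (fun s => ctrmx (A s)) t (ctrmx dA).
Proof.
move=> HA i j; rewrite ctrmxE; under eq_fun do rewrite ctrmxE.
exact: is_cderive_conj.
Qed.

Lemma ex_cderive_det n (A : R -> 'M[C]_n) t :
  (forall i j, exists d, is_cderive (fun s => A s i j) t d) ->
  exists d, is_cderive (fun s => \det (A s)) t d.
Proof.
move=> HA; apply: ex_cderive_sum => u.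
have [d Hd] : exists d, is_cderive (fun s => \prod_i A s i (u i)) t d.
  by apply: ex_cderive_prod => i.
by eexists; exact: (is_cderiveM (is_cderive_cst _ _) Hd).
Qed.

(** The cofactor formula gives existence of a derivative only; its value is found afterwards.
    Invertibility is assumed at every [s], as regularized Gram matrices provide, so the formula
    holds on the whole line. *)
Lemma ex_cderive_invmx n (A : R -> 'M[C]_n) t i j :
  (forall s, A s \in unitmx) ->
  (forall i j, exists d, is_cderive (fun s => A s i j) t d) ->
  exists d, is_cderive (fun s => invmx (A s) i j) t d.
Proof.
move=> uA HA.
have -> : (fun s => invmx (A s) i j) = (fun s => (\det (A s))^-1 * cofactor (A s) j i).
  by apply/funext => s; rewrite /invmx uA !mxE.
have [d1 H1] : exists d, is_cderive (fun s => (\det (A s))^-1) t d.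
  apply: ex_cderiveV; last exact: ex_cderive_det.
  by have := uA t; rewrite unitmxE unitfE.
have [d2 H2] : exists d, is_cderive (fun s => cofactor (A s) j i) t d.
  have [d Hd] : exists d, is_cderive (fun s => \det (row' j (col' i (A s)))) t d.
    apply: ex_cderive_det => k l; have [d Hd] := HA (lift j k) (lift i l).
    by exists d; under eq_fun do rewrite !mxE.
  by eexists; exact: (is_cderiveM (is_cderive_cst _ _) Hd).
by eexists; exact: (is_cderiveM H1 H2).
Qed.

Lemma is_mxderive_invmx n (A : R -> 'M[C]_n) t dA :
  (forall s, A s \in unitmx) -> is_mxderive A t dA ->
  is_mxderive (fun s => invmx (A s)) t (- (invmx (A t) *m dA *m invmx (A t))).
Proof.
move=> uA HA.
pose dV := \matrix_(i, j) cderive (fun s => invmx (A s) i j) t.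
have HV : is_mxderive (fun s => invmx (A s)) t dV.
  move=> i j; rewrite mxE; apply: ex_cderiveP; apply: ex_cderive_invmx => // k l.
  by eexists; exact: HA.
(* The product [invmx (A s) *m A s] is constantly the identity, so its derivative [dV A + V dA]
   vanishes; this is solved for [dV]. *)
have := is_mxderiveM HV HA; under eq_fun do rewrite mulVmx //.
move/is_mxderive_unique => /(_ _ (is_mxderive_cst _ _)) /eqP.
rewrite addr_eq0 => /eqP E.
suff -> : - (invmx (A t) *m dA *m invmx (A t)) = dV by [].
by rewrite -mulNmx -E mulmxK.
Qed.

End MatrixDerivative.

Section ResolventDerivative.
Variables (R : realType) (m n : nat) (e : R) (G : R -> 'M[R[i]]_(m, n)) (t : R).
Variable dG : 'M[R[i]]_(m, n).
Hypotheses (e_gt0 : 0 < e) (HG : is_mxderive G t dG).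
Local Notation V := (resolvent e (G t)).

Lemma is_mxderive_resolvent : is_mxderive (fun s => resolvent e (G s)) t
  (- (V *m (dG *m ctrmx (G t) + G t *m ctrmx dG) *m V)).
Proof.
apply: (@is_mxderive_invmx _ _ (fun s => reg_gram e (G s))).
  by move=> s; exact: reg_gram_unit.
rewrite -[X in is_mxderive _ _ X]addr0.
apply: (is_mxderiveD _ (is_mxderive_cst _ _)).
by apply: is_mxderiveM => //; exact: is_mxderive_ctrmx.
Qed.

Lemma is_mxderive_resolventG : is_mxderive (fun s => resolvent e (G s) *m G s) t
  (V *m dG - V *m (dG *m ctrmx (G t) + G t *m ctrmx dG) *m (V *m G t)).
Proof.
rewrite addrC mulmxA -mulNmx.
exact: (is_mxderiveM is_mxderive_resolvent HG).
Qed.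

End ResolventDerivative.

Lemma mulmx_delta_mx (F : comNzRingType) (m n k l : nat)
    (A : 'M[F]_(k, m)) (B : 'M[F]_(n, l)) i j a b :
  (A *m delta_mx i j *m B) a b = A a i * B j b.
Proof.
rewrite -(mul_delta_mx (0 : 'I_1)) mulmxA -colE -mulmxA -rowE mxE big_ord1.
by rewrite !mxE.
Qed.

(* For [c = 1] and [c = 'i], the squares [p_ij ^+ 2] contribute with opposite signs
   to the real, resp. imaginary, part. *)
Lemma resolventG_dir (R : rcfType) (m n : nat) (e : R) (G : 'M[R[i]]_(m, n)) i j (c : R[i])
    (dG := c *: delta_mx i j) (V := resolvent e G) : 0 < e ->
  (V *m dG - V *m (dG *m ctrmx G + G *m ctrmx dG) *m (V *m G)) i j =
  c * real_complex R (resolvent_diag e G i * (1 - proj_diag e G j))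
  - conjc c * (V *m G) i j ^+ 2.
Proof.
move=> e0.
have -> : ctrmx dG = conjc c *: delta_mx j i.
  apply/matrixP => k l; rewrite ctrmxE !mxE rmorphM; congr (_ * _).
  by rewrite andbC rmorph_nat.
have -> : V *m dG = c *: (V *m delta_mx i j *m 1%:M) by rewrite mulmx1 -scalemxAr.
have -> : V *m (dG *m ctrmx G + G *m (conjc c *: delta_mx j i)) *m (V *m G) =
    c *: (V *m delta_mx i j *m (ctrmx G *m (V *m G)))
    + conjc c *: (V *m G *m delta_mx j i *m (V *m G)).
  by rewrite mulmxDr mulmxDl /dG -!scalemxAl -!scalemxAr -!scalemxAl !mulmxA.
move: (V *m G) (resolvent_diagE G e0 i) (proj_diagE G e0 j) => p Vii Kjj.
rewrite mxE mxE mulmx_delta_mx [X in _ + X]mxE [X in _ - X]mxE.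
rewrite [X in _ - (X + _)]mxE [X in _ - (_ + X)]mxE !mulmx_delta_mx Kjj.
rewrite -[V i i]/(resolvent e G i i) Vii mxE eqxx.
have -> : real_complex R (resolvent_diag e G i * (1 - proj_diag e G j)) =
    real_complex R (resolvent_diag e G i) * (1 - real_complex R (proj_diag e G j)).
  by rewrite rmorphM rmorphB rmorph1.
by rewrite mulr1 expr2 !mulrBr mulr1 opprD addrA.
Qed.

(** * Stein's identity for the normal distribution *)

Section NormalIntegral.
Variables (R : realType) (s : R).
Hypothesis s_neq0 : s != 0.
Local Notation mu := (@lebesgue_measure R).
Local Notation phi := (@normal_pdf R 0 s).
Local Notation nu := (@normal_prob R 0 s).

(** The Radon-Nikodym derivative of the normal law agrees almost everywhere with the density, since
    both have the same integral over every measurable set. The nonnegative version comes first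
    because it is what proves integrability, a hypothesis of the signed version. *)
Lemma ge0_integral_normal_prob (f : R -> \bar R) :
  (forall x, 0 <= f x)%E -> measurable_fun setT f ->
  (\int[nu]_x f x = \int[mu]_x (f x * (phi x)%:E))%E.
Proof.
move=> f0 mf; have dom := @normal_prob_dominates R 0 s.
rewrite -(Radon_Nikodym_SigmaFinite.change_of_variables dom) //.
have mphi : measurable_fun setT (EFin \o phi).
  by apply/measurable_EFinP; exact: measurable_normal_pdf.
have iRN := Radon_Nikodym_SigmaFinite.f_integrable dom.
apply: ae_eq_integral => //.
- by apply: emeasurable_funM => //; exact: measurable_int iRN.
- exact: emeasurable_funM.
- apply: ae_eqe_mul2l; apply: integral_ae_eq => // E _ mE.
  by rewrite -Radon_Nikodym_SigmaFinite.f_integral.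
Qed.

Lemma integral_normal_prob (f : R -> \bar R) :
  nu.-integrable setT f ->
  (\int[nu]_x f x = \int[mu]_x (f x * (phi x)%:E))%E.
Proof.
move=> intf; have dom := @normal_prob_dominates R 0 s.
rewrite -(Radon_Nikodym_change_of_variables dom) //.
have mphi : measurable_fun setT (EFin \o phi).
  by apply/measurable_EFinP; exact: measurable_normal_pdf.
have iRN := @Radon_Nikodym_integrable _ _ R (charge_of_finite_measure nu) mu dom.
have mf := measurable_int _ intf.
apply: ae_eq_integral => //.
- by apply: emeasurable_funM => //; exact: measurable_int iRN.
- exact: emeasurable_funM.
- apply: ae_eqe_mul2l; apply: integral_ae_eq => // E _ mE.
  by rewrite -Radon_Nikodym_integral.
Qed.

(* The factor [1 + t ^+ 2] is absorbed by doubling the variance. *)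
Lemma sqr_normal_pdf_le : exists2 K : R, 0 <= K &
  forall t, (1 + t ^+ 2) * phi t <= K * normal_pdf 0 (s * Num.sqrt 2) t.
Proof.
have s2 : s * Num.sqrt 2 != 0.
  by rewrite mulf_neq0 // gt_eqF // sqrtr_gt0.
pose q := normal_peak s; pose q' := normal_peak (s * Num.sqrt 2).
have q0 : 0 <= q by exact: normal_peak_ge0.
have q'0 : 0 < q' by exact: normal_peak_gt0.
(* With [u = t^2 / (4 s^2)] the density is [q exp(-2u)] and the wider one is [q' exp(-u)]. The
   constant comes from [1 + t^2 = 1 + 4 s^2 u <= (1 + 4 s^2) (1 + u) <= (1 + 4 s^2) exp(u)]. *)
exists ((1 + 4 * s ^+ 2) * (q / q')).
  apply: mulr_ge0; first by rewrite addr_ge0 // mulr_ge0 // sqr_ge0.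
  by rewrite divr_ge0 // ltW.
move=> t; rewrite !normal_pdfE //= -/q -/q' /normal_fun subr0 exprMn sqr_sqrtr //.
pose u := t ^+ 2 / (4 * s ^+ 2).
have s20 : s ^+ 2 != 0 by rewrite sqrf_eq0.
have -> : - t ^+ 2 / (s ^+ 2 *+ 2) = - u - u.
  by rewrite /u -mulr_natr; field.
have -> : - t ^+ 2 / (s ^+ 2 * 2 *+ 2) = - u.
  by rewrite /u -mulr_natr; field.
have tE : t ^+ 2 = 4 * s ^+ 2 * u by rewrite /u; field.
have u0 : 0 <= u by rewrite /u divr_ge0 ?sqr_ge0 // mulr_ge0 // sqr_ge0.
rewrite expRD mulrCA; set E := expR (- u).
have -> : (1 + 4 * s ^+ 2) * (q / q') * (q' * E) = q * ((1 + 4 * s ^+ 2) * E).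
  by field; rewrite gt_eqF.
rewrite ler_wpM2l // mulrA ler_wpM2r ?expR_ge0 //.
rewrite /E expRN ler_pdivrMr ?expR_gt0 //.
apply: (@le_trans _ _ ((1 + 4 * s ^+ 2) * (1 + u))).
  by rewrite {1}tE; have := sqr_ge0 s; nra.
by rewrite ler_wpM2l ?expR_ge1Dx // addr_ge0 // mulr_ge0 // sqr_ge0.
Qed.

Lemma integrable_sqr_normal_pdf :
  mu.-integrable setT (fun t => ((1 + t ^+ 2) * phi t)%:E).
Proof.
have [K K0 HK] := sqr_normal_pdf_le.
apply: (@le_integrable _ _ _ mu setT measurableT _
  (fun t => (K * normal_pdf 0 (s * Num.sqrt 2) t)%:E)).
- apply/measurable_EFinP; apply: measurable_funM; last exact: measurable_normal_pdf.
  by apply: measurable_funD => //; apply: measurable_funX.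
- move=> t _; rewrite lee_fin !ger0_norm ?HK //.
    by rewrite mulr_ge0 // normal_pdf_ge0.
  by rewrite mulr_ge0 ?normal_pdf_ge0 // addr_ge0 ?sqr_ge0.
- under eq_fun do rewrite EFinM.
  apply: integrableZl => //; exact: integrable_normal_pdf.
Qed.

Lemma integrable_normal_pdfM (g : R -> R) (K : R) :
  measurable_fun setT g -> (forall t, `|g t| <= K * (1 + t ^+ 2)) ->
  mu.-integrable setT (fun t => (g t * phi t)%:E).
Proof.
move=> mg Hg.
apply: (@le_integrable _ _ _ mu setT measurableT _
  (fun t => K%:E * ((1 + t ^+ 2) * phi t)%:E)%E).
- apply/measurable_EFinP; apply: measurable_funM => //; exact: measurable_normal_pdf.
- move=> t _; rewrite lee_fin !normrM mulrA ler_wpM2r //.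
  by apply: le_trans (Hg t) _; rewrite -normrM; exact: ler_norm.
- apply: integrableZl => //; exact: integrable_sqr_normal_pdf.
Qed.

Lemma integrable_normal_prob (g : R -> R) (K : R) :
  measurable_fun setT g -> (forall t, `|g t| <= K * (1 + t ^+ 2)) ->
  nu.-integrable setT (EFin \o g).
Proof.
move=> mg Hg; apply/integrableP; split; first exact/measurable_EFinP.
rewrite ge0_integral_normal_prob //=; last first.
  by apply/measurable_EFinP; exact: measurableT_comp.
have /integrableP[_] := integrable_normal_pdfM mg Hg.
congr (_ < _)%E; apply: eq_integral => t _ /=.
by rewrite normrM (ger0_norm (normal_pdf_ge0 _ _ _)).
Qed.

Lemma is_derive_normal_pdf (t : R) : is_derive t 1 phi (- (t / s ^+ 2) * phi t).
Proof.
rewrite normal_pdfE //.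
have s20 : s ^+ 2 != 0 by rewrite sqrf_eq0.
pose h (x : R) := - x ^+ 2 / (s ^+ 2 *+ 2).
have dh : is_derive t 1 h (- (t / s ^+ 2)).
  have -> : h = (- (s ^+ 2 *+ 2)^-1) \*: ((id : R -> R) * (id : R -> R)).
    by apply/funext => x; rewrite /h mulNr mulrC -mulNr expr2.
  refine (is_derive_eq (is_deriveZ _ (is_deriveM (is_derive_id t 1) (is_derive_id t 1))) _).
  rewrite /GRing.scale /= -mulr_natr; field.
  by rewrite s_neq0.
have de := is_derive1_comp (is_derive_expR (h t)) dh.
have -> : (fun x => normal_peak s * normal_fun 0 s x) = normal_peak s \*: (expR \o h).
  by apply/funext => x; rewrite /normal_fun subr0.
refine (is_derive_eq (is_deriveZ _ de) _).
by rewrite /GRing.scale /= /normal_fun subr0 /h; ring.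
Qed.

(* Integration of [(f * phi)' = f' * phi - t f phi / s ^+ 2] over the line. *)
Lemma stein (f f' : R -> R) (K : R) :
  (forall t : R, is_derive t 1 f (f' t)) -> continuous f' ->
  (forall t, `|f t| <= K * (1 + `|t|)) -> (forall t, `|f' t| <= K) ->
  (\int[nu]_t (t * f t)%:E = (s ^+ 2)%:E * \int[nu]_t (f' t)%:E)%E.
Proof.
move=> df cf' Hf Hf'.
have K0 : 0 <= K by apply: le_trans (Hf' 0).
have s20 : s ^+ 2 != 0 by rewrite sqrf_eq0.
have cf : continuous f.
  move=> t; apply: differentiable_continuous; apply/derivable1_diffP.
  exact: (@ex_derive _ _ _ _ _ _ _ (df t)).
have mf : measurable_fun setT f by exact: continuous_measurable_fun.
have mf' : measurable_fun setT f' by exact: continuous_measurable_fun.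
have tabs (t : R) : `|t| * (1 + `|t|) <= 2 * (1 + t ^+ 2).
  by have := sqr_ge0 (`|t| - 1); have := real_normK (num_real t); nra.
have mtf : measurable_fun setT (fun t : R => t * f t) by exact: measurable_funM.
have Htf t : `|t * f t| <= (2 * K) * (1 + t ^+ 2).
  rewrite normrM; apply: le_trans (_ : `|t| * (K * (1 + `|t|)) <= _).
    by rewrite ler_wpM2l.
  by have := tabs t; nra.
have Hf'2 t : `|f' t| <= K * (1 + t ^+ 2).
  by apply: le_trans (Hf' t) _; have := sqr_ge0 t; nra.
have i1 := integrable_normal_pdfM mtf Htf.
have i2 := integrable_normal_pdfM mf' Hf'2.
rewrite (integral_normal_prob (integrable_normal_prob mtf Htf)).
rewrite (integral_normal_prob (integrable_normal_prob mf' Hf'2)) /=.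
under eq_integral do rewrite -EFinM.
under [X in (_ = _ * X)%E]eq_integral do rewrite -EFinM.
pose F := f * phi.
pose H (t : R) := f' t * phi t - (s ^+ 2)^-1 * (t * f t * phi t).
have dF (t : R) : is_derive t 1 F (H t).
  refine (is_derive_eq (is_deriveM (df t) (is_derive_normal_pdf t)) _).
  by rewrite /GRing.scale /= /H; field.
have cphi := continuous_normal_pdf (m := 0) s_neq0.
have cF : continuous F by move=> t; apply: cvgM; [exact: cf|exact: cphi].
have cH : continuous H.
  move=> t; apply: cvgB; first by apply: cvgM; [exact: cf'|exact: cphi].
  apply: cvgM; first exact: cvg_cst.
  apply: cvgM; last exact: cphi.
  by apply: cvgM; [exact: cvg_id|exact: cf].
have iH : mu.-integrable setT (EFin \o H).
  rewrite (_ : EFin \o H = (fun t => (f' t * phi t)%:E) \-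
     (fun t => ((s ^+ 2)^-1)%:E * (t * f t * phi t)%:E))%E; last first.
    by apply/funext => t.
  by apply: integrableB => //; exact: integrableZl.
suff : (\int[mu]_t (H t)%:E = 0)%E.
  move=> HI; have : (\int[mu]_t (f' t * phi t)%:E -
      ((s ^+ 2)^-1)%:E * \int[mu]_t (t * f t * phi t)%:E = 0)%E.
    rewrite -HI -integralZl // -integralB //; last exact: integrableZl.
  have /fineK <- := integrable_fin_num measurableT i1.
  have /fineK <- := integrable_fin_num measurableT i2.
  move: (fine _) (fine _) => a b /eqP.
  rewrite -!EFinM -EFinB eqe => /eqP E; congr (_%:E).
  have -> : b = (s ^+ 2)^-1 * a by apply/eqP; rewrite -subr_eq0 E.
  by field.
(* The endpoints use [n.+1] so that the interval is nondegenerate already at [n = 0]. *)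
have FTC (n : nat) : (\int[mu]_(t in `[(- n.+1%:R)%R, n.+1%:R]) (H t)%:E =
    (F n.+1%:R)%:E - (F (- n.+1%:R))%:E)%E.
  apply: continuous_FTC2.
  - by rewrite ltrNl -subr_gt0 opprK addr_gt0.
  - exact: continuous_subspaceT.
  - split; first by move=> t _; exact: (@ex_derive _ _ _ _ _ _ _ (dF t)).
    + by apply: cvg_at_right_filter; exact: cF.
    + by apply: cvg_at_left_filter; exact: cF.
  - by move=> t _; rewrite derive1E; exact: (@derive_val _ _ _ _ _ _ _ (dF t)).
(* Decay of the boundary terms: [|F t| (1 + |t|) <= K (1 + |t|)^2 phi t <= 2 K (1 + t^2) phi t],
   which is at most a multiple of the peak of the wider Gaussian. *)
have [Q Q0 HQ] : exists2 Q : R, 0 <= Q & forall t, `|F t| <= Q * (1 + `|t|)^-1.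
  have [Q Q0 HQ] := sqr_normal_pdf_le.
  pose Q' := Q * normal_peak (s * Num.sqrt 2).
  have Q'0 : 0 <= Q' by rewrite mulr_ge0 // normal_peak_ge0.
  exists (K * (2 * Q')); first by rewrite mulr_ge0 // mulr_ge0.
  move=> t; have t1 : 0 < 1 + `|t| by rewrite ltr_wpDr.
  rewrite ler_pdivlMr // normrM (ger0_norm (normal_pdf_ge0 _ _ _)).
  have H1 : (1 + t ^+ 2) * phi t <= Q'.
    apply: le_trans (HQ t) _; rewrite ler_wpM2l // normal_pdf_ub //.
    by rewrite mulf_neq0 // gt_eqF // sqrtr_gt0.
  apply: (@le_trans _ _ (K * (1 + `|t|) * phi t * (1 + `|t|))).
    by rewrite ler_wpM2r ?(ltW t1) // ler_wpM2r ?normal_pdf_ge0.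
  rewrite -!mulrA ler_wpM2l //.
  have p0 := normal_pdf_ge0 0 s t.
  have H2 : (1 + `|t|) * (1 + `|t|) <= 2 * (1 + t ^+ 2).
    by have := sqr_ge0 (`|t| - 1); have := real_normK (num_real t); nra.
  apply: (@le_trans _ _ (2 * (1 + t ^+ 2) * phi t)).
    by rewrite mulrCA mulrC ler_wpM2r.
  by rewrite -mulrA ler_wpM2l.
(* The integrals over growing intervals tend to the integral of [H] over the line, by dominated
   convergence with [|H|] as the bound. *)
pose D (n : nat) := `[(- n.+1%:R : R)%R, n.+1%:R]%classic.
pose Hn n := (EFin \o H) \_ (D n).
have mD n : measurable (D n) by exact: measurable_itv.
have mH : measurable_fun setT (EFin \o H) by exact: measurable_int iH.
have [] := @dominated_convergence _ _ _ mu setT measurableT Hn (EFin \o H)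
    (fun t => `|(H t)%:E|)%E.
- move=> n; apply/(measurable_restrictT _ (mD n)); exact: measurable_funTS.
- exact: mH.
- apply: aeW => t _.
  apply: cvg_near_cst; near=> n; rewrite /Hn patchE mem_set //.
  rewrite /D /= in_itv /= -ler_norml ltW //.
  near: n; exists (Num.trunc `|t|) => // n /= tn.
  by apply: lt_le_trans (truncnS_gt _) _; rewrite ler_nat ltnS.
- exact: integrable_abse.
- apply: aeW => t n _; rewrite /Hn patchE; case: ifP => _ //.
  by rewrite abse0.
move=> _ _ /=.
have -> : (fun n => \int[mu]_x Hn n x)%E = (fun n => (F n.+1%:R - F (- n.+1%:R))%:E).
  by apply/funext => n; rewrite -integral_mkcond FTC.
move=> cvgI; have cvg0 : (F n.+1%:R - F (- n.+1%:R)) @[n --> \oo] --> (0 : R).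
  apply: norm_cvg0.
  apply: (@squeeze_cvgr _ _ _ _ (fun=> 0) (fun n => (2 * Q) * harmonic n)).
  - apply: nearW => n; rewrite normr_ge0 /=.
    apply: le_trans (ler_normB _ _) _.
    have H1 x : `|x| = n.+1%:R -> `|F x| <= Q * harmonic n.
      move=> xn; apply: le_trans (HQ x) _; rewrite xn ler_wpM2l //.
      by rewrite /harmonic /= lef_pV2 ?posrE ?ltr_wpDr // lerDr.
    have := H1 n.+1%:R (normr_nat _ _).
    have := H1 (- n.+1%:R); rewrite normrN normr_nat => /(_ erefl) h1 h2.
    by apply: le_trans (lerD h2 h1) _; rewrite -mulrA mulr_natl mulr2n.
  - exact: cvg_cst.
  - rewrite -[X in _ --> X](mulr0 (2 * Q)).
    by apply: cvgM; [exact: cvg_cst|exact: cvg_harmonic].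
have {}cvg0 : (F n.+1%:R - F (- n.+1%:R))%:E @[n --> \oo] --> 0%:E.
  by apply: cvg_EFin => //; exact: nearW.
exact: (cvg_unique _ cvgI cvg0).
Unshelve. all: by end_near.
Qed.

End NormalIntegral.

(** * Stein's identity in one of several independent coordinates *)

Definition upd (I : eqType) (R : Type) (x : I -> R) (k : I) (t : R) : I -> R :=
  fun j => if j == k then t else x j.

Lemma upd_id (I : eqType) (R : Type) (x : I -> R) (k : I) : upd x k (x k) = x.
Proof. by apply/funext => j; rewrite /upd; case: eqP => [->|]. Qed.

(** Measurability is tested by substituting arbitrary measurable coordinates, with no sigma-algebra
    on [I -> R]. The same hypothesis then serves on [T] and on the product space used for Fubini's
    theorem. *)
Definition coord_measurable (I : finType) (R : realType) (f : (I -> R) -> R) : Prop :=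
  forall d (D : measurableType d) (Y : I -> D -> R),
    (forall j, measurable_fun setT (Y j)) ->
    measurable_fun setT (fun z => f (fun j => Y j z)).

Section JointStein.
Context d (T : measurableType d) (R : realType) (P : probability T R).
Variables (I : finType) (X : I -> {RV P >-> R}).
Hypothesis indX : mutually_independent X.
Variable k : I.

(* [offType] is [T] with the sigma-algebra generated by the coordinates other than [k]. *)
Definition cylinders_off : set (set T) :=
  [set A | exists2 B : I -> set R, (forall j, measurable (B j)) /\ B k = setT &
     A = \bigcap_(j in [set: I]) (X j @^-1` B j)].

Definition offType := g_sigma_algebraType cylinders_off.

Lemma measurable_bigcap_preimage (B : I -> set R) :
  (forall j, measurable (B j)) ->
  measurable (\bigcap_(j in [set: I]) (X j @^-1` B j)).
Proof.
move=> mB; apply: fin_bigcap_measurable; first exact: finite_finset.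
by move=> j _; rewrite -[X in measurable X]setTI; exact: measurable_funP.
Qed.

Lemma cylinders_off_setI_closed : setI_closed cylinders_off.
Proof.
move=> _ _ [B [mB Bk] ->] [B' [mB' B'k] ->].
exists (fun j => B j `&` B' j).
  by split=> [j|]; [exact: measurableI|rewrite Bk B'k setTI].
by rewrite -bigcapI.
Qed.

(** The identity map into the coarser sigma-algebra; the image of [P] under it is the restriction of
    [P] to events determined by the other coordinates. *)
Definition to_off (w : T) : offType := w.

Lemma measurable_to_off : measurable_fun setT to_off.
Proof.
apply: (@measurability _ _ T offType setT to_off cylinders_off erefl).
move=> _ [_ [B [mB _] ->] <-]; rewrite setTI.
exact: measurable_bigcap_preimage.
Qed.

HB.instance Definition _ := isMeasurableFun.Build _ _ _ _ to_off measurable_to_off.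

Lemma measurable_coord_off j : j != k -> measurable_fun setT (fun w : offType => X j w).
Proof.
move=> jk _ B mB; rewrite setTI; apply: sub_sigma_algebra.
exists (fun l => if l == j then B else setT).
  by split=> [l|]; [case: ifP|rewrite eq_sym (negbTE jk)].
apply/seteqP; split=> [w /= Bw l _|w /(_ j Logic.I)]; last by rewrite eqxx.
by case: eqP => [->|].
Qed.

(** For fixed [B] both sides are finite measures in [A]. They agree on the cylinders, which are
    closed under intersection and generate the sigma-algebra, so they are equal. *)
Lemma indep_off (B : set R) (A : set offType) : measurable B -> measurable A ->
  P ((X k @^-1` B) `&` A) = (P (X k @^-1` B) * P A)%E.
Proof.
move=> mB mA; set E := X k @^-1` B.
have mE : measurable E by rewrite -[E]setTI; exact: measurable_funP.
have [m1 m1E] : exists m1 : {measure set offType -> \bar R},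
    forall S, m1 S = P (S `&` E).
  unshelve refine (ex_intro _
    (pushforward (mrestr P mE) to_off : {measure set offType -> \bar R}) _) => //.
pose c : {nonneg R} := NngNum (fine_ge0 (measure_ge0 P E)).
pose m2 := mscale c (distribution P to_off).
have m2E S : m2 S = (P E * P S)%E.
  by rewrite /m2 /mscale /= fineK ?fin_num_measure.
have : m1 A = m2 A.
  apply: (@measure_unique _ R offType cylinders_off (fun=> setT) erefl) => //.
  - exact: cylinders_off_setI_closed.
  - move=> _; exists (fun=> setT) => //.
    by apply/seteqP; split.
  - by rewrite bigcup_const //; exists 0%N.
  - move=> _ [C [mC Ck] ->]; rewrite m1E -[RHS]/(m2 _) m2E.
    (* A cylinder leaves index [k] free, so its intersection with [E] is again a bigcap of
       preimages, with [B] placed at [k], and mutual independence factors it. *)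
    pose C' j := if j == k then B else C j.
    have mC' j : measurable (C' j) by rewrite /C'; case: ifP.
    rewrite [X in P X](_ : _ = \bigcap_(j in [set: I]) (X j @^-1` C' j)); last first.
      apply/seteqP; split=> [w [wC wE] j _|w wC].
        by rewrite /C' /=; case: eqP => [->|_] //; exact: wC.
      split=> [j _|]; last by have := wC k Logic.I; rewrite /C' eqxx.
      by have := wC j Logic.I; rewrite /C' /=; case: eqP => [->|//]; rewrite Ck.
    rewrite indX // (bigD1 k) //= {1}/C' eqxx; congr (_ * _)%E.
    rewrite [RHS](indX mC) [RHS](bigD1 k) //= Ck preimage_setT probability_setT mul1e.
    by apply: eq_bigr => j /negbTE jk; rewrite /C' jk.
  - move=> _; rewrite m1E.
    by rewrite (le_lt_trans (probability_le1 P _)) ?ltry //; exact: measurableI.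
by rewrite m1E m2E setIC.
Qed.

Variable s : R.
Hypothesis s_neq0 : s != 0.
Hypothesis lawX : forall A, measurable A -> distribution P (X k) A = normal_prob 0 s A.

(* [normal_prob] is a measure on [measurableTypeR R], which unification does not identify
   with the canonical measurable structure of [R]. *)
Definition coordR (w : T) : measurableTypeR R := X k w.

Lemma measurable_coordR : measurable_fun setT coordR.
Proof. exact: (measurable_funPT (X k)). Qed.

HB.instance Definition _ := isMeasurableFun.Build _ _ _ _ coordR measurable_coordR.

Lemma integrable_coord (g : R -> R) (K : R) :
  measurable_fun setT g -> (forall t, `|g t| <= K * (1 + t ^+ 2)) ->
  P.-integrable setT (fun w => (g (X k w))%:E).
Proof.
move=> mg Hg; apply/integrableP; split.
  by apply/measurable_EFinP; exact: measurableT_comp.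
have /integrableP[_] := integrable_normal_prob s_neq0 mg Hg.
congr (_ < _)%E.
transitivity (\int[distribution P coordR]_t `|(g t)%:E|)%E.
  by apply: eq_measure_integral => A mA _; apply/esym; exact: lawX.
rewrite ge0_integral_distribution //.
by apply/measurable_EFinP; exact: measurableT_comp.
Qed.

Definition joint_off (w : T) : measurableTypeR R * offType := (X k w, to_off w).

Lemma measurable_joint_off : measurable_fun setT joint_off.
Proof.
have mX : measurable_fun setT (X k : T -> measurableTypeR R).
  exact: (measurable_funPT (X k)).
exact: (@measurable_fun_pair _ _ _ T (measurableTypeR R) offType (X k) to_off).
Qed.

HB.instance Definition _ := isMeasurableFun.Build _ _ _ _ joint_off measurable_joint_off.

(** A finite measure on the product is determined by its values on rectangles, and there the product
    rule is [indep_off] combined with the law of [X k]. *)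
Lemma distribution_joint_off A : measurable A ->
  (normal_prob 0 s \x distribution P to_off)%E A = distribution P joint_off A.
Proof.
move=> mA.
apply: (@product_measure_unique _ _ (measurableTypeR R) offType R (normal_prob 0 s)
  (distribution P to_off) (distribution P joint_off)) => // A1 A2 mA1 mA2.
transitivity (distribution P (X k) A1 * P A2)%E; first exact: indep_off.
by congr (_ * _)%E; exact: lawX.
Qed.

Lemma integrable_joint_off (h : measurableTypeR R * offType -> R) :
  measurable_fun setT h -> P.-integrable setT (fun w => (h (joint_off w))%:E) ->
  (normal_prob 0 s \x distribution P to_off)%E.-integrable setT (EFin \o h).
Proof.
move=> mh ih.
have mh' : measurable_fun setT (EFin \o h) by exact/measurable_EFinP.
have ih' : (distribution P joint_off).-integrable setT (EFin \o h).
  exact: (integrable_pushforward measurable_joint_off mh' ih).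
apply/integrableP; split => //.
move/integrableP : ih' => [_]; congr (_ < _)%E; apply: eq_measure_integral => A mA _.
exact/esym/distribution_joint_off.
Qed.

Lemma integral_joint_off (h : measurableTypeR R * offType -> R) :
  measurable_fun setT h -> P.-integrable setT (fun w => (h (joint_off w))%:E) ->
  (\int[P]_w (h (joint_off w))%:E =
   \int[distribution P to_off]_w \int[normal_prob 0 s]_t (h (t, w))%:E)%E.
Proof.
move=> mh ih.
have mh' : measurable_fun setT (EFin \o h) by exact/measurable_EFinP.
have -> : (\int[P]_w (h (joint_off w))%:E = \int[distribution P joint_off]_z (h z)%:E)%E.
  by rewrite integral_distribution.
have E : (\int[normal_prob 0 s \x distribution P to_off]_z (h z)%:E =
    \int[distribution P joint_off]_z (h z)%:E)%E.
  by apply: eq_measure_integral => // A mA _; exact: distribution_joint_off.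
by rewrite -E -integral21_prod_meas1 //; exact: integrable_joint_off.
Qed.

(* Conditionally on the other coordinates, this is the one-dimensional identity. *)
Lemma stein_coord (f f' : (I -> R) -> R) :
  coord_measurable f -> coord_measurable f' ->
  (forall x (t : R), is_derive t 1 (fun u => f (upd x k u)) (f' (upd x k t))) ->
  (forall x, continuous (fun t => f' (upd x k t))) ->
  (forall x, exists K, forall t : R, `|f (upd x k t)| <= K * (1 + `|t|) /\
                                 `|f' (upd x k t)| <= K) ->
  P.-integrable setT (fun w => (X k w * f (X ^~ w))%:E) ->
  P.-integrable setT (fun w => (f' (X ^~ w))%:E) ->
  (\int[P]_w (X k w * f (X ^~ w))%:E = (s ^+ 2)%:E * \int[P]_w (f' (X ^~ w))%:E)%E.
Proof.
move=> mf mf' df cf' bf i1 i2.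
(* The full family is rebuilt from a value for coordinate [k] and a point [w] supplying the rest.
   Coordinate [k] of [w] is never read, which is why [Y j] is measurable for the coarser
   sigma-algebra. *)
pose Y (j : I) (z : measurableTypeR R * offType) : R := upd (X ^~ z.2) k z.1 j.
have mY j : measurable_fun setT (Y j).
  rewrite /Y /upd; case: eqP => [_|/eqP jk]; first exact: measurable_fst.
  exact: measurableT_comp (measurable_coord_off jk) measurable_snd.
pose h1 (z : measurableTypeR R * offType) : R := z.1 * f (fun j => Y j z).
pose h2 (z : measurableTypeR R * offType) : R := f' (fun j => Y j z).
have mh1 : measurable_fun setT h1.
  by apply: measurable_funM; [exact: measurable_fst|exact: mf].
have mh2 : measurable_fun setT h2 by exact: mf'.
have YE w : (fun j => Y j (joint_off w)) = X ^~ w by exact: (upd_id (X ^~ w) k).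
have E1 : (fun w => (X k w * f (X ^~ w))%:E) = (fun w => (h1 (joint_off w))%:E).
  by apply/funext => w; rewrite /h1 YE.
have E2 : (fun w => (f' (X ^~ w))%:E) = (fun w => (h2 (joint_off w))%:E).
  by apply/funext => w; rewrite /h2 YE.
rewrite E1 E2 in i1 i2 *.
rewrite -integralZl //; under [RHS]eq_integral do rewrite -EFinM.
pose h3 z := s ^+ 2 * h2 z.
have mh3 : measurable_fun setT h3 by exact: measurable_funM.
have i3 : P.-integrable setT (fun w => (h3 (joint_off w))%:E).
  by under eq_fun do rewrite /h3 EFinM; exact: integrableZl.
rewrite (integral_joint_off mh1 i1) (integral_joint_off mh3 i3).
apply: eq_integral => w _.
have [K HK] := bf (X ^~ w).
have K0 : 0 <= K by have [_] := HK 0; exact: le_trans.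
have mf'w : measurable_fun setT (fun t => f' (upd (X ^~ w) k t)).
  exact: continuous_measurable_fun (cf' _).
have bf'w t : `|f' (upd (X ^~ w) k t)| <= K * (1 + t ^+ 2).
  have [_ H] := HK t; apply: le_trans H _.
  by rewrite ler_peMr // lerDl sqr_ge0.
rewrite (@stein _ _ s_neq0 (fun t => f (upd (X ^~ w) k t))
  (fun t => f' (upd (X ^~ w) k t)) K) //.
- by rewrite -integralZl //; exact: integrable_normal_prob mf'w bf'w.
- by move=> t; have [] := HK t.
- by move=> t; have [] := HK t.
Qed.

End JointStein.

(** * Measurability of complex matrix functions *)

Section ComplexMeasurable.
Context d (D : measurableType d) (R : realType).
Local Notation C := R[i].
Implicit Types f g : D -> C.

Definition cmeas f : Prop :=
  measurable_fun setT (fun z => complex.Re (f z)) /\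
  measurable_fun setT (fun z => complex.Im (f z)).

Lemma cmeas_cst (c : C) : cmeas (fun=> c).
Proof. by split; exact: measurable_cst. Qed.

Lemma cmeasD f g : cmeas f -> cmeas g -> cmeas (fun z => f z + g z).
Proof.
move=> [f1 f2] [g1 g2]; split.
- by under eq_fun do rewrite Re_add; exact: measurable_funD.
- by under eq_fun do rewrite Im_add; exact: measurable_funD.
Qed.

Lemma cmeasM f g : cmeas f -> cmeas g -> cmeas (fun z => f z * g z).
Proof.
move=> [f1 f2] [g1 g2]; split.
- under eq_fun do rewrite Re_mul.
  by apply: measurable_funB; exact: measurable_funM.
- under eq_fun do rewrite Im_mul.
  by apply: measurable_funD; exact: measurable_funM.
Qed.

Lemma cmeas_conj f : cmeas f -> cmeas (fun z => conjc (f z)).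
Proof.
move=> [f1 f2]; split.
- by rewrite (_ : (fun _ => _) = fun z => complex.Re (f z)) //; apply/funext => z; case: (f z).
- rewrite (_ : (fun _ => _) = fun z => - complex.Im (f z)); last first.
    by apply/funext => z; case: (f z).
  exact: measurable_funN.
Qed.

Lemma cmeas_sum (I : Type) (r : seq I) (Q : pred I) (F : I -> D -> C) :
  (forall i, cmeas (F i)) -> cmeas (fun z => \sum_(i <- r | Q i) F i z).
Proof.
move=> H; elim: r => [|i r IH].
  by under eq_fun do rewrite big_nil; exact: cmeas_cst.
case Qi : (Q i); last by under eq_fun do rewrite big_cons Qi.
by under eq_fun do rewrite big_cons Qi; exact: cmeasD.
Qed.

Lemma cmeas_prod (I : Type) (r : seq I) (Q : pred I) (F : I -> D -> C) :
  (forall i, cmeas (F i)) -> cmeas (fun z => \prod_(i <- r | Q i) F i z).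
Proof.
move=> H; elim: r => [|i r IH].
  by under eq_fun do rewrite big_nil; exact: cmeas_cst.
case Qi : (Q i); last by under eq_fun do rewrite big_cons Qi.
by under eq_fun do rewrite big_cons Qi; exact: cmeasM.
Qed.

Lemma measurable_nsq f : cmeas f -> measurable_fun setT (fun z => nsq (f z)).
Proof. by move=> [f1 f2]; apply: measurable_funD; exact: measurable_funX. Qed.

Lemma cmeasV f : cmeas f -> cmeas (fun z => (f z)^-1).
Proof.
move=> mf; have [f1 f2] := mf.
have mi : measurable_fun setT (fun z => (nsq (f z))^-1).
  (* The real power [-1] agrees with the total inverse on all nonnegative reals, including 0, and is
     measurable. *)
  under eq_fun do rewrite -powR_inv1 ?nsq_ge0 //.
  exact: measurableT_comp (@measurable_powR R _) (measurable_nsq mf).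
split; under eq_fun do rewrite inv_complexE /=.
- exact: measurable_funM.
- by apply: measurable_funN; exact: measurable_funM.
Qed.

Definition mxmeas m n (A : D -> 'M[C]_(m, n)) : Prop :=
  forall i j, cmeas (fun z => A z i j).

Lemma mxmeas_cst m n (A : 'M[C]_(m, n)) : mxmeas (fun=> A).
Proof. by move=> i j; exact: cmeas_cst. Qed.

Lemma mxmeasD m n (A B : D -> 'M[C]_(m, n)) :
  mxmeas A -> mxmeas B -> mxmeas (fun z => A z + B z).
Proof.
by move=> mA mB i j; under eq_fun do rewrite mxE; exact: cmeasD.
Qed.

Lemma mxmeasM m n k (A : D -> 'M[C]_(m, n)) (B : D -> 'M[C]_(n, k)) :
  mxmeas A -> mxmeas B -> mxmeas (fun z => A z *m B z).
Proof.
move=> mA mB i j; under eq_fun do rewrite mxE.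
by apply: cmeas_sum => l; exact: cmeasM.
Qed.

Lemma mxmeas_ctrmx m n (A : D -> 'M[C]_(m, n)) :
  mxmeas A -> mxmeas (fun z => ctrmx (A z)).
Proof.
by move=> mA i j; under eq_fun do rewrite ctrmxE; exact: cmeas_conj.
Qed.

Lemma cmeas_det n (A : D -> 'M[C]_n) : mxmeas A -> cmeas (fun z => \det (A z)).
Proof.
move=> mA; apply: cmeas_sum => u; apply: cmeasM; first exact: cmeas_cst.
by apply: cmeas_prod => i.
Qed.

Lemma measurable_unitmx n (A : D -> 'M[C]_n) : mxmeas A ->
  measurable_fun setT (fun z => A z \in unitmx).
Proof.
move=> mA.
rewrite (_ : (fun _ => _) = fun z => (0 < nsq (\det (A z)))%R); last first.
  apply/funext => z; rewrite unitmxE unitfE lt_neqAle nsq_ge0 andbT [0 == nsq _]eq_sym.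
  congr negb; apply/eqP/eqP => [->|/nsq_eq0 //].
  by rewrite /nsq /= expr0n addr0.
apply: measurable_fun_ltr; first exact: measurable_cst.
exact/measurable_nsq/cmeas_det.
Qed.

Lemma mxmeas_invmx n (A : D -> 'M[C]_n) : mxmeas A -> mxmeas (fun z => invmx (A z)).
Proof.
move=> mA i j.
have mc : cmeas (fun z => (\det (A z))^-1 * cofactor (A z) j i).
  apply: cmeasM; first exact/cmeasV/cmeas_det.
  apply: cmeasM; first exact: cmeas_cst.
  apply: cmeas_det => k l; under eq_fun do rewrite !mxE; exact: mA.
have mu := measurable_unitmx mA.
(* On a singular matrix [invmx] returns the matrix itself, hence the second branch. *)
rewrite (_ : (fun _ => _) = fun z => if A z \in unitmx then
  (\det (A z))^-1 * cofactor (A z) j i else A z i j); last first.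
  by apply/funext => z; rewrite /invmx; case: ifP; rewrite ?mxE // mxE.
have [c1 c2] := mc; have [a1 a2] := mA i j.
split.
- rewrite (_ : (fun _ => _) = fun z => if A z \in unitmx then
    complex.Re ((\det (A z))^-1 * cofactor (A z) j i) else complex.Re (A z i j)).
    exact: measurable_fun_ifT.
  by apply/funext => z; case: ifP.
- rewrite (_ : (fun _ => _) = fun z => if A z \in unitmx then
    complex.Im ((\det (A z))^-1 * cofactor (A z) j i) else complex.Im (A z i j)).
    exact: measurable_fun_ifT.
  by apply/funext => z; case: ifP.
Qed.

Lemma mxmeas_resolvent m n (e : R) (A : D -> 'M[C]_(m, n)) :
  mxmeas A -> mxmeas (fun z => resolvent e (A z)).
Proof.
move=> mA; apply: mxmeas_invmx; apply: mxmeasD; last exact: mxmeas_cst.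
by apply: mxmeasM => //; exact: mxmeas_ctrmx.
Qed.

Lemma measurable_cvnorm n (v : D -> 'cV[C]_n) : mxmeas v ->
  measurable_fun setT (fun z => cvnorm (v z)).
Proof.
move=> mv; rewrite (_ : (fun _ => _) = fun z => (\sum_k nsq (v z k 0)) `^ (2^-1)).
  apply: measurableT_comp (@measurable_powR R _) _.
  by apply: measurable_sum => k; exact: measurable_nsq.
apply/funext => z; rewrite powR12_sqrt // sumr_ge0 // => k _; exact: nsq_ge0.
Qed.

End ComplexMeasurable.

(** * Stein's identity summed over a family of coordinates *)

Section SteinSum.
Context d (T : measurableType d) (R : realType) (P : probability T R).
Variables (I : finType) (X : I -> {RV P >-> R}).
Hypothesis indX : mutually_independent X.
Variable s : R.
Hypothesis s_neq0 : s != 0.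

Variables (J : finType) (c : J -> I).
Hypothesis lawX : forall j A, measurable A ->
  distribution P (X (c j)) A = normal_prob 0 s A.

(** The divergence form of the identity. [J] indexes coordinates sharing the variance [s ^+ 2]:
    those of [G] in one application, those of [x] in the other. *)
Lemma stein_sum (f f' : J -> (I -> R) -> R) :
  (forall j, coord_measurable (f j)) -> (forall j, coord_measurable (f' j)) ->
  (forall j x (t : R), is_derive t 1 (fun u => f j (upd x (c j) u)) (f' j (upd x (c j) t))) ->
  (forall j x, continuous (fun t => f' j (upd x (c j) t))) ->
  (forall j x, exists K, forall t : R, `|f j (upd x (c j) t)| <= K * (1 + `|t|) /\
                                 `|f' j (upd x (c j) t)| <= K) ->
  (forall j, P.-integrable setT (fun w => (X (c j) w * f j (X ^~ w))%:E)) ->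
  (forall j, P.-integrable setT (fun w => (f' j (X ^~ w))%:E)) ->
  (\int[P]_w (\sum_j X (c j) w * f j (X ^~ w))%:E =
   (s ^+ 2)%:E * \int[P]_w (\sum_j f' j (X ^~ w))%:E)%E.
Proof.
move=> mf mf' df cf' bf i1 i2.
under eq_integral do rewrite -sumEFin.
under [X in (_ = _ * X)%E]eq_integral do rewrite -sumEFin.
rewrite integral_sum // integral_sum //.
transitivity (\sum_j (s ^+ 2)%:E * \int[P]_w (f' j (X ^~ w))%:E)%E.
  apply: eq_bigr => j _; exact: (stein_coord indX s_neq0 (@lawX j)).
pose a j := fine (\int[P]_w (f' j (X ^~ w))%:E).
have aE j : (\int[P]_w (f' j (X ^~ w))%:E = (a j)%:E)%E.
  by rewrite fineK // (integrable_fin_num measurableT (i2 j)).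
rewrite (eq_bigr (fun j => (s ^+ 2 * a j)%:E)); last by move=> j _; rewrite aE.
rewrite sumEFin [in RHS](eq_bigr (fun j => (a j)%:E)); last by move=> j _; rewrite aE.
by rewrite sumEFin -EFinM mulr_sumr.
Qed.

End SteinSum.

(** * Test functions for Stein's identity *)

Lemma big_pair_bool (R : nmodType) (J : finType) (F : J * bool -> R) :
  \sum_k F k = \sum_j (F (j, false) + F (j, true)).
Proof.
rewrite -(eq_bigr _ (fun k _ => congr1 F (esym (surjective_pairing k)))).
rewrite -(pair_bigA _ (fun j b => F (j, b))) /=.
by apply: eq_bigr => j _; rewrite big_bool /= addrC.
Qed.

Lemma abs_le_of_sqr (R : realFieldType) (a c : R) : a ^+ 2 <= c -> `|a| <= 1 + c.
Proof.
by move=> ac; have := sqr_ge0 (`|a| - 1); have := real_normK (num_real a); nra.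
Qed.

Section Coordinates.
Variables (R : realType) (L N : nat).
Local Notation C := R[i].
Local Notation I := (coord_idx L N).
Implicit Types (x : I -> R) (e t : R).

(** The random matrix [Gmat] as a function of a deterministic coordinate family, so that [upd] can
    move one coordinate at a time; at [X ^~ w] it is [Gmat X w]. *)
Definition Gof x : 'M[C]_(L, N) :=
  \matrix_(i < L, j < N) Complex (x (inl (i, j, false))) (x (inl (i, j, true))).

Definition xof x : 'cV[C]_L :=
  \col_(i < L) Complex (x (inr (i, false))) (x (inr (i, true))).

Definition part (b : bool) (z : C) : R := if b then complex.Im z else complex.Re z.

Lemma sqr_part_le b z : part b z ^+ 2 <= nsq z.
Proof. by case: b; [exact: sqr_Im_le_nsq|exact: sqr_Re_le_nsq]. Qed.

Lemma is_derive_upd x (k l : I) t : is_derive t 1 (fun u => upd x k u l) ((l == k)%:R).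
Proof.
by rewrite /upd; case: (l == k); [exact: is_derive_id|exact: is_derive_cst].
Qed.

Lemma is_mxderive_Gof x (k : I) t : is_mxderive (fun u => Gof (upd x k u)) t
  (\matrix_(a, c) Complex (inl (a, c, false) == k)%:R (inl (a, c, true) == k)%:R).
Proof.
move=> a c; rewrite mxE; split => /=.
- by under eq_fun do rewrite mxE /=; exact: is_derive_upd.
- by under eq_fun do rewrite mxE /=; exact: is_derive_upd.
Qed.

Lemma is_mxderive_xof x (k : I) t : is_mxderive (fun u => xof (upd x k u)) t
  (\col_a Complex (inr (a, false) == k)%:R (inr (a, true) == k)%:R).
Proof.
move=> a c; rewrite mxE; split => /=.
- by under eq_fun do rewrite mxE /=; exact: is_derive_upd.
- by under eq_fun do rewrite mxE /=; exact: is_derive_upd.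
Qed.

(** The direction in which an entry moves when its real ([false]) or imaginary ([true]) coordinate
    varies. *)
Definition dir (b : bool) : C := if b then Complex 0 1 else 1.

Lemma is_mxderive_Gof_inl x i j b t :
  is_mxderive (fun u => Gof (upd x (inl (i, j, b)) u)) t (dir b *: delta_mx i j).
Proof.
suff -> : dir b *: delta_mx i j = \matrix_(a, c) Complex
    ((inl (a, c, false) : I) == inl (i, j, b))%:R
    ((inl (a, c, true) : I) == inl (i, j, b))%:R by exact: is_mxderive_Gof.
apply/matrixP => a c; rewrite !mxE.
have E b' : ((inl (a, c, b') : I) == inl (i, j, b)) = (a == i) && (c == j) && (b' == b) by [].
rewrite !E /dir {E}; case: (a == i) => /=; case: (c == j) => /=; case: b => /=;
  by apply: eq_ReIm; rewrite ?Re_mul ?Im_mul /= ?mulr0 ?mulr1 ?mul0r ?subr0 ?addr0 ?add0r.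
Qed.

Lemma Gof_upd_inr x i b t : Gof (upd x (inr (i, b)) t) = Gof x.
Proof. by apply/matrixP => a c; rewrite !mxE. Qed.

Lemma is_mxderive_xof_inr x i b t :
  is_mxderive (fun u => xof (upd x (inr (i, b)) u)) t (dir b *: delta_mx i 0).
Proof.
suff -> : dir b *: delta_mx i 0 = \col_a Complex
    ((inr (a, false) : I) == inr (i, b))%:R
    ((inr (a, true) : I) == inr (i, b))%:R by exact: is_mxderive_xof.
apply/matrixP => a c; rewrite !mxE ord1 eqxx andbT.
have E b' : ((inr (a, b') : I) == inr (i, b)) = (a == i) && (b' == b) by [].
rewrite !E /dir {E}; case: (a == i) => /=; case: b => /=;
  by apply: eq_ReIm; rewrite ?Re_mul ?Im_mul /= ?mulr0 ?mulr1 ?mul0r ?subr0 ?addr0 ?add0r.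
Qed.

Lemma is_derive_part b (f : R -> C) t df : is_cderive f t df ->
  is_derive t 1 (fun u => part b (f u)) (part b df).
Proof. by move=> [f1 f2]; case: b. Qed.

Lemma continuous_part b (f : R -> C) : (forall t, exists df, is_cderive f t df) ->
  continuous (fun u => part b (f u)).
Proof.
move=> Hf t; have [df Hdf] := Hf t.
apply: differentiable_continuous; apply/derivable1_diffP.
exact: (@ex_derive _ _ _ _ _ _ _ (is_derive_part b Hdf)).
Qed.

Definition fG e (k : 'I_L * 'I_N * bool) x : R :=
  part k.2 ((resolvent e (Gof x) *m Gof x) k.1.1 k.1.2).

(** The matching part of the formula in [resolventG_dir]. With [d] the real product and [p] the
    entry, the real part of [d - p^2] is [d - Re (p^2)], and the imaginary part of [i d + i p^2] is
    [d + Re (p^2)]; this is the origin of the sign. *)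
Definition dfG e (k : 'I_L * 'I_N * bool) x : R :=
  resolvent_diag e (Gof x) k.1.1 * (1 - proj_diag e (Gof x) k.1.2) +
  (-1) ^+ (~~ k.2) * complex.Re ((resolvent e (Gof x) *m Gof x) k.1.1 k.1.2 ^+ 2).

Definition fx e (k : 'I_L * bool) x : R :=
  part k.2 ((resolvent e (Gof x) *m xof x) k.1 0).

(** The coordinates of [x] do not affect [V], and [V i i] is real, so the real and the imaginary
    coordinate of [x_i] give the same derivative. *)
Definition dfx e (k : 'I_L * bool) x : R := resolvent_diag e (Gof x) k.1.

Variable e : R.
Hypothesis e_gt0 : 0 < e.

Lemma is_derive_fG k x t :
  is_derive t 1 (fun u => fG e k (upd x (inl k) u)) (dfG e k (upd x (inl k) t)).
Proof.
case: k => [[i j] b].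
have H := is_mxderive_resolventG e_gt0 (is_mxderive_Gof_inl x i j b t) i j.
have := is_derive_part b H; rewrite resolventG_dir //.
congr (is_derive _ _ _ _); rewrite /dfG /=.
case: b {H} => /=; rewrite /dir.
- rewrite Im_add Im_opp !Im_mul /= mulr0 mul1r add0r mul0r add0r.
  by rewrite expr0 mulN1r opprK mul1r.
- rewrite Re_add Re_opp !Re_mul /= !mul1r oppr0 !mul0r !subr0.
  by rewrite expr1 mulN1r.
Qed.

Lemma is_derive_fx k x t :
  is_derive t 1 (fun u => fx e k (upd x (inr k) u)) (dfx e k (upd x (inr k) t)).
Proof.
case: k => [i b]; rewrite /fx /dfx /=.
under eq_fun do rewrite Gof_upd_inr; rewrite Gof_upd_inr.
have := is_mxderiveM (is_mxderive_cst (resolvent e (Gof x)) t) (is_mxderive_xof_inr x i b t).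
move=> /(_ i 0) /(is_derive_part b); congr (is_derive _ _ _ _).
rewrite mul0mx add0r -scalemxAr -colE !mxE resolvent_diagE //.
by case: b; rewrite /dir /part ?Im_mul ?Re_mul /= ?mul1r ?mul0r ?mulr0 ?add0r ?subr0.
Qed.

(** In this form the results on continuity and measurability of matrix entries apply to the
    diagonal. *)
Lemma resolvent_diag_part (G : 'M[C]_(L, N)) i :
  resolvent_diag e G i = part false (resolvent e G i i).
Proof. by rewrite resolvent_diagE. Qed.

Lemma proj_diag_part (G : 'M[C]_(L, N)) j :
  proj_diag e G j = part false ((ctrmx G *m (resolvent e G *m G)) j j).
Proof. by rewrite proj_diagE. Qed.

Lemma continuous_dfG k x : continuous (fun t => dfG e k (upd x (inl k) t)).
Proof.
case: k => [[i j] b] t; rewrite /dfG /=.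
have dG u := is_mxderive_Gof_inl x i j b u.
have dp u := is_mxderive_resolventG e_gt0 (dG u).
apply: cvgD.
- apply: cvgM.
    under eq_fun do rewrite resolvent_diag_part; rewrite resolvent_diag_part.
    apply: (continuous_part (f := fun u => resolvent e (Gof (upd x (inl (i, j, b)) u)) i i)) => u.
    by eexists; exact: (is_mxderive_resolvent e_gt0 (dG u) i i).
  apply: cvgB; first exact: cvg_cst.
  under eq_fun do rewrite proj_diag_part; rewrite proj_diag_part.
  apply: (continuous_part (f := fun u => (ctrmx (Gof (upd x (inl (i, j, b)) u)) *m
     (resolvent e (Gof (upd x (inl (i, j, b)) u)) *m Gof (upd x (inl (i, j, b)) u))) j j)) => u.
  by eexists; exact: (is_mxderiveM (is_mxderive_ctrmx (dG u)) (dp u) j j).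
- apply: cvgM; first exact: cvg_cst.
  apply: (continuous_part (b := false) (f := fun u =>
    (resolvent e (Gof (upd x (inl (i, j, b)) u)) *m Gof (upd x (inl (i, j, b)) u)) i j ^+ 2)) => u.
  by eexists; exact: (is_cderiveM (dp u i j) (dp u i j)).
Qed.

Lemma continuous_dfx k x : continuous (fun t => dfx e k (upd x (inr k) t)).
Proof.
case: k => [i b].
rewrite (_ : (fun _ => _) = cst (resolvent_diag e (Gof x) i)).
  by move=> t; exact: cvg_cst.
by apply/funext => t; rewrite /dfx Gof_upd_inr.
Qed.

Lemma abs_fG_le k x : `|fG e k x| <= 1 + e^-1.
Proof.
apply: abs_le_of_sqr; apply: le_trans (sqr_part_le _ _) _.
exact: nsq_resolventG_le.
Qed.

Lemma abs_dfG_le k x : `|dfG e k x| <= e^-1 + e^-1.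
Proof.
apply: le_trans (ler_normD _ _) _; apply: lerD.
- rewrite normrM ger0_norm ?resolvent_diag_ge0 //.
  rewrite ger0_norm ?subr_ge0 ?proj_diag_le1 //.
  apply: le_trans (resolvent_diag_le (Gof x) e_gt0 k.1.1).
  rewrite ler_piMr ?resolvent_diag_ge0 // gerBl; exact: proj_diag_ge0.
- rewrite normrM normrX normrN1 expr1n mul1r.
  apply: le_trans (nsq_resolventG_le (Gof x) e_gt0 k.1.1 k.1.2).
  rewrite expr2 Re_mul -!expr2 /nsq.
  set a := complex.Re _; set b := complex.Im _.
  by rewrite ler_norml; have := sqr_ge0 a; have := sqr_ge0 b; lra.
Qed.

Lemma abs_dfx_le k x : `|dfx e k x| <= e^-1.
Proof.
rewrite /dfx ger0_norm ?resolvent_diag_ge0 //; exact: resolvent_diag_le.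
Qed.

Lemma sqr_fx_le k x : fx e k x ^+ 2 <= L%:R * e^-1 ^+ 2 * \sum_l x (inr l) ^+ 2.
Proof.
apply: le_trans (sqr_part_le _ _) _; rewrite mxE.
apply: le_trans (nsq_sum_le _) _; rewrite -mulrA ler_wpM2l // mulr_sumr.
rewrite [X in _ <= X]big_pair_bool ler_sum // => l _.
rewrite nsqM -mulrDr ler_pM ?nsq_ge0 ?nsq_resolvent_le //.
by rewrite mxE.
Qed.

(** Unlike the entries of [V G], those of [V x] are unbounded; they grow at most linearly in [t],
    with a constant that depends on the other coordinates. *)
Lemma fx_growth k x : exists K, forall t : R,
  `|fx e k (upd x (inr k) t)| <= K * (1 + `|t|) /\ `|dfx e k (upd x (inr k) t)| <= K.
Proof.
pose A := L%:R * e^-1 ^+ 2.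
have A0 : 0 <= A by rewrite mulr_ge0 // sqr_ge0.
pose S := \sum_l x (inr l) ^+ 2.
have S0 : 0 <= S by rewrite sumr_ge0 // => l _; exact: sqr_ge0.
have e0 : 0 <= e^-1 by rewrite invr_ge0 ltW.
(* The summand [e^-1] bounds [dfx]. The summands [A * S] and [A] give [A (S + t^2) <= K (1 + t^2)],
   and the summand 1 gives [K <= K^2], which allows comparison with the square of [K (1 + |t|)]. *)
exists (1 + A * S + A + e^-1) => t; split; last first.
  apply: le_trans (abs_dfx_le _ _) _; rewrite lerDr.
  by rewrite addr_ge0 // addr_ge0 // mulr_ge0.
have Ht : \sum_l upd x (inr k) t (inr l) ^+ 2 <= S + t ^+ 2.
  rewrite (bigD1 k) //= {1}/upd eqxx addrC lerD2r /S [X in _ <= X](bigD1 k) //=.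
  rewrite -[X in X <= _]add0r lerD ?sqr_ge0 // ler_sum // => l lk.
  rewrite /upd; case: eqP => // -[lk']; by rewrite lk' eqxx in lk.
have H := sqr_fx_le k (upd x (inr k) t); rewrite -/A in H.
have {}H : `|fx e k (upd x (inr k) t)| ^+ 2 <= A * (S + t ^+ 2).
  by rewrite real_normK ?num_real //; apply: le_trans H _; rewrite ler_wpM2l.
rewrite -(@ler_pXn2r _ 2) ?nnegrE //; last by rewrite mulr_ge0 ?addr_ge0 ?mulr_ge0.
apply: le_trans H _.
pose M := 1 + A * S + A + e^-1.
have M1 : 1 <= M by rewrite /M -!addrA lerDl !addr_ge0 ?mulr_ge0.
have MA : A * S <= M by rewrite /M; have := mulr_ge0 A0 S0; lra.
have MA' : A <= M by rewrite /M; have := mulr_ge0 A0 S0; lra.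
rewrite -/M; apply: (@le_trans _ _ (M * (1 + t ^+ 2))).
  by rewrite !mulrDr mulr1 lerD // ler_wpM2r ?sqr_ge0.
rewrite exprMn; apply: ler_pM => //.
- by apply: le_trans M1.
- by rewrite addr_ge0 ?sqr_ge0.
- by rewrite expr2 ler_peMr // (le_trans _ M1).
- by have := real_normK (num_real t); have := normr_ge0 t; nra.
Qed.

(** For each entry the two coordinates contribute the real part of [conjc (G i j) * p i j]; over all
    [i] and [j] these add up to the trace of [G^H p], that is [tr K]. *)
Lemma sum_fG x : \sum_k x (inl k) * fG e k x = \sum_j proj_diag e (Gof x) j.
Proof.
rewrite big_pair_bool.
rewrite -(eq_bigr _ (fun k _ => congr1 (fun k => x (inl (k, false)) * fG e (k, false) x
   + x (inl (k, true)) * fG e (k, true) x) (esym (surjective_pairing k)))).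
rewrite -(pair_bigA _ (fun i j => x (inl ((i, j), false)) * fG e ((i, j), false) x
   + x (inl ((i, j), true)) * fG e ((i, j), true) x)) /= exchange_big.
apply: eq_bigr => j _; rewrite proj_diag_part /part mxE Re_sum.
apply: eq_bigr => i _; rewrite ctrmxE Re_mul /fG /part /=.
by rewrite [Gof x i j]mxE /=; ring.
Qed.

(** The terms in [p i j ^+ 2] have opposite signs in the two parts and cancel, while the real
    product is counted twice. *)
Lemma sum_dfG x : \sum_k dfG e k x =
  2 * ((\sum_i resolvent_diag e (Gof x) i) * (N%:R - \sum_j proj_diag e (Gof x) j)).
Proof.
rewrite big_pair_bool.
under eq_bigr => k _.
  rewrite /dfG /= expr1 expr0 mulN1r mul1r addrACA [- _ + _]addrC subrr addr0 -mulr2n -mulr_natl.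
  over.
rewrite -mulr_sumr; congr (_ * _).
rewrite -(pair_bigA _ (fun i j => resolvent_diag e (Gof x) i * (1 - proj_diag e (Gof x) j))) /=.
rewrite mulr_suml; apply: eq_bigr => i _; rewrite -mulr_sumr; congr (_ * _).
by rewrite sumrB sumr_const card_ord.
Qed.

Lemma sum_fx x : \sum_k x (inr k) * fx e k x =
  complex.Re ((ctrmx (xof x) *m (resolvent e (Gof x) *m xof x)) 0 0).
Proof.
rewrite big_pair_bool mxE Re_sum; apply: eq_bigr => i _.
rewrite ctrmxE Re_mul /fx /part /=.
by rewrite [xof x i 0]mxE /=; ring.
Qed.

Lemma sum_dfx x : \sum_k dfx e k x = 2 * \sum_i resolvent_diag e (Gof x) i.
Proof.
rewrite big_pair_bool mulr_sumr; apply: eq_bigr => i _.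
by rewrite /dfx /= -mulr2n mulr_natl.
Qed.

Section Measurability.
Context d (D : measurableType d) (Y : I -> D -> R).
Hypothesis mY : forall j, measurable_fun setT (Y j).
Local Notation Yz z := (fun j => Y j z).

Lemma mxmeas_Gof : mxmeas (fun z => Gof (Yz z)).
Proof. by move=> i j; split; under eq_fun do rewrite mxE /=; exact: mY. Qed.

Lemma mxmeas_xof : mxmeas (fun z => xof (Yz z)).
Proof. by move=> i j; split; under eq_fun do rewrite mxE /=; exact: mY. Qed.

Lemma measurable_part b (f : D -> C) : cmeas f -> measurable_fun setT (fun z => part b (f z)).
Proof. by move=> [f1 f2]; case: b. Qed.

Lemma mxmeas_resolventG : mxmeas (fun z => resolvent e (Gof (Yz z)) *m Gof (Yz z)).
Proof. by apply: mxmeasM mxmeas_Gof; exact/mxmeas_resolvent/mxmeas_Gof. Qed.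

Lemma measurable_resolvent_diag i :
  measurable_fun setT (fun z => resolvent_diag e (Gof (Yz z)) i).
Proof.
under eq_fun do rewrite resolvent_diag_part.
by apply: measurable_part; exact: (mxmeas_resolvent e mxmeas_Gof i i).
Qed.

Lemma measurable_proj_diag j :
  measurable_fun setT (fun z => proj_diag e (Gof (Yz z)) j).
Proof.
under eq_fun do rewrite proj_diag_part.
apply: measurable_part.
exact: (mxmeasM (mxmeas_ctrmx mxmeas_Gof) mxmeas_resolventG j j).
Qed.

End Measurability.

Lemma coord_measurable_fG k : coord_measurable (fG e k).
Proof.
move=> d D Y mY; apply: measurable_part; exact: (mxmeas_resolventG mY).
Qed.

Lemma coord_measurable_dfG k : coord_measurable (dfG e k).
Proof.
move=> d D Y mY; apply: measurable_funD; apply: measurable_funM => //.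
- exact: measurable_resolvent_diag.
- by apply: measurable_funB => //; exact: measurable_proj_diag.
- apply: (measurable_part false).
  by apply: cmeasM; exact: (mxmeas_resolventG mY).
Qed.

Lemma coord_measurable_fx k : coord_measurable (fx e k).
Proof.
move=> d D Y mY; apply: measurable_part.
exact: (mxmeasM (mxmeas_resolvent e (mxmeas_Gof mY)) (mxmeas_xof mY)).
Qed.

Lemma coord_measurable_dfx k : coord_measurable (dfx e k).
Proof. by move=> d D Y mY; exact: measurable_resolvent_diag. Qed.

End Coordinates.

(** * Moments of the pseudo-inverse *)

Lemma le_limn_einf (R : realType) (u v : (\bar R)^nat) :
  (forall n, u n <= v n)%E -> (limn_einf u <= limn_einf v)%E.
Proof.
move=> uv; rewrite !limn_einf_lim; apply: lee_lim; [exact: is_cvg_einfs|exact: is_cvg_einfs|].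
apply: nearW => n; apply: le_ereal_inf_tmp => _ [m /= nm <-].
by apply: le_trans (uv m); apply: ereal_inf_lbound; exists m.
Qed.

Lemma integrable_bounded d (T : measurableType d) (R : realType) (P : probability T R)
    (g : T -> R) (K : R) :
  measurable_fun setT g -> (forall w, `|g w| <= K) ->
  P.-integrable setT (fun w => (g w)%:E).
Proof.
move=> mg gK; apply: (@le_integrable _ _ _ P setT measurableT _ (cst K%:E)).
- exact/measurable_EFinP.
- by move=> w _; rewrite lee_fin; apply: le_trans (gK w) (ler_norm _).
- exact: finite_measure_integrable_cst.
Qed.

Section PseudoInverse.
Variables (R : realType) (L N : nat) (d : measure_display).
Context (T : measurableType d) (P : probability T R).
Variables (X : coord_idx L N -> {RV P >-> R}) (s1 s2 : R).
Hypotheses (s1_neq0 : s1 != 0) (s2_neq0 : s2 != 0) (indX : mutually_independent X).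
Hypothesis lawG : forall k A, measurable A ->
  distribution P (X (inl k)) A = normal_prob 0 s1 A.
Hypothesis lawx : forall k A, measurable A ->
  distribution P (X (inr k)) A = normal_prob 0 s2 A.
Hypothesis LN : (L < N)%N.

Local Notation Xw w := (fun k => X k w).
Local Notation trV e w := (\sum_i resolvent_diag e (Gof (Xw w)) i).
Local Notation quad e w :=
  (complex.Re ((ctrmx (xof (Xw w)) *m (resolvent e (Gof (Xw w)) *m xof (Xw w))) 0 0)).

Let mX k : measurable_fun setT (X k).
Proof. exact: measurable_funPT. Qed.

Lemma measurable_trV e : 0 < e -> measurable_fun setT (fun w => trV e w).
Proof.
move=> e0; apply: measurable_sum => i; exact: (measurable_resolvent_diag e0 mX).
Qed.

Lemma trV_ge0 e w : 0 < e -> 0 <= trV e w.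
Proof. by move=> e0; rewrite sumr_ge0 // => i _; exact: resolvent_diag_ge0. Qed.

Lemma trV_le e w : 0 < e -> trV e w <= L%:R * e^-1.
Proof.
move=> e0; apply: le_trans (_ : \sum_(i < L) e^-1 <= _).
  by apply: ler_sum => i _; exact: resolvent_diag_le.
by rewrite sumr_const card_ord mulr_natl.
Qed.

Lemma integrable_trV e : 0 < e -> P.-integrable setT (fun w => (trV e w)%:E).
Proof.
move=> e0; apply: (@integrable_bounded _ _ _ P _ (L%:R * e^-1)); first exact: measurable_trV.
by move=> w; rewrite ger0_norm ?trV_ge0 // trV_le.
Qed.

(** Here [s1] is the standard deviation of one real coordinate, so [s1 ^+ 2 * 2] is the variance of
    a complex entry. The bound is uniform in [e], which is what the passage to the limit
    requires. *)
Lemma integral_trV_le e : 0 < e ->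
  (\int[P]_w (trV e w)%:E <= (L%:R / (s1 ^+ 2 * 2 * (N%:R - L%:R)))%:E)%E.
Proof.
move=> e0.
have s10 : 0 < s1 ^+ 2 by rewrite exprn_even_gt0.
have NL : 0 < N%:R - L%:R :> R by rewrite subr_gt0 ltr_nat.
pose K := 1 + e^-1 + e^-1.
have e'0 : 0 <= e^-1 by rewrite invr_ge0 ltW.
have iX k : P.-integrable setT (fun w => (X (inl k) w)%:E).
  apply: (@integrable_coord _ _ _ _ _ _ _ _ s1_neq0 (@lawG k) id 1) => // t.
  by have := sqr_ge0 (`|t| - 1); have := real_normK (num_real t); nra.
have mf k : measurable_fun setT (fun w => fG e k (Xw w)).
  exact: (coord_measurable_fG e k mX).
have mf' k : measurable_fun setT (fun w => dfG e k (Xw w)).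
  exact: (coord_measurable_dfG e0 k mX).
have i1 k : P.-integrable setT (fun w => (X (inl k) w * fG e k (Xw w))%:E).
  apply: (@le_integrable _ _ _ P setT measurableT _ (fun w => K%:E * (X (inl k) w)%:E)%E).
  - by apply/measurable_EFinP; exact: measurable_funM.
  - move=> w _; rewrite lee_fin !normrM mulrC ler_wpM2r //.
    apply: le_trans (abs_fG_le e0 _ _) _; apply: le_trans (ler_norm K).
    by rewrite /K lerDl.
  - exact: integrableZl.
have i2 k : P.-integrable setT (fun w => (dfG e k (Xw w))%:E).
  by apply: (@integrable_bounded _ _ _ P _ (e^-1 + e^-1)) => // w; exact: abs_dfG_le.
have := stein_sum indX s1_neq0 lawG (coord_measurable_fG e) (coord_measurable_dfG e0)
  (is_derive_fG e0) (continuous_dfG e0) _ i1 i2.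
have bd (j : 'I_L * 'I_N * bool) x : exists K0, forall t : R,
    `|fG e j (upd x (inl j) t)| <= K0 * (1 + `|t|) /\ `|dfG e j (upd x (inl j) t)| <= K0.
  exists K => t; split.
    apply: le_trans (abs_fG_le e0 _ _) _; apply: (@le_trans _ _ K); first by rewrite /K lerDl.
    by rewrite ler_peMr ?lerDl // /K !addr_ge0.
  by apply: le_trans (abs_dfG_le e0 _ _) _; rewrite /K -addrA lerDr.
move=> /(_ bd).
under eq_integral do rewrite sum_fG //.
under [X in (_ = _ * X)%E]eq_integral do rewrite sum_dfG //.
move=> E.
have mp : measurable_fun setT (fun w => \sum_j proj_diag e (Gof (Xw w)) j).
  by apply: measurable_sum => j; exact: (measurable_proj_diag e0 mX).
have p0 w : 0 <= \sum_j proj_diag e (Gof (Xw w)) j.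
  by rewrite sumr_ge0 // => j _; exact: proj_diag_ge0.
have H1 : (\int[P]_w (\sum_j proj_diag e (Gof (Xw w)) j)%:E <= L%:R%:E)%E.
  apply: (@le_trans _ _ (\int[P]_w (cst L%:R%:E w))%E); last first.
    by rewrite integral_cst //= probability_setT mule1.
  apply: ge0_le_integral => //.
  - by move=> w _; rewrite lee_fin.
  - exact/measurable_EFinP.
  - by move=> w _; rewrite lee_fin; exact: sum_proj_diag_le.
have H2 : ((2 * (N%:R - L%:R))%:E * \int[P]_w (trV e w)%:E <=
  \int[P]_w (2 * (trV e w * (N%:R - \sum_j proj_diag e (Gof (Xw w)) j)))%:E)%E.
  rewrite -integralZl //; last exact: integrable_trV.
  have pw w : 2 * (N%:R - L%:R) * trV e w <=
      2 * (trV e w * (N%:R - \sum_j proj_diag e (Gof (Xw w)) j)).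
    rewrite -mulrA ler_pM2l // mulrC ler_wpM2l ?trV_ge0 // lerD2l lerN2.
    exact: sum_proj_diag_le.
  have t0 w : 0 <= 2 * (N%:R - L%:R) * trV e w.
    by rewrite mulr_ge0 ?trV_ge0 // mulr_ge0 // ltW.
  apply: ge0_le_integral => //.
  - by move=> w _; rewrite -EFinM lee_fin.
  - by apply/measurable_EFinP; apply: measurable_funM => //; exact: measurable_trV.
  - apply/measurable_EFinP; apply: measurable_funM => //; apply: measurable_funM.
      exact: measurable_trV.
    exact: measurable_funB.
  - by move=> w _; rewrite -EFinM lee_fin.
have /fineK tE := integrable_fin_num measurableT (integrable_trV e0).
move: E H1 H2; rewrite -tE => E H1 H2.
rewrite lee_fin ler_pdivlMr; last by rewrite mulr_gt0 // mulr_gt0.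
rewrite -lee_fin; apply: le_trans H1; rewrite E.
apply: (@le_trans _ _ ((s1 ^+ 2)%:E * ((2 * (N%:R - L%:R)) *
   fine (\int[P]_w (trV e w)%:E))%:E)%E).
  by rewrite -EFinM lee_fin le_eqVlt; apply/orP; left; apply/eqP; ring.
by rewrite lee_pmul2l // lte_fin.
Qed.

Lemma measurable_quad e : measurable_fun setT (fun w => quad e w).
Proof.
have := mxmeasM (mxmeas_ctrmx (mxmeas_xof mX))
  (mxmeasM (mxmeas_resolvent e (mxmeas_Gof mX)) (mxmeas_xof mX)).
by move=> /(_ 0 0) [].
Qed.

Lemma integral_quad e : 0 < e ->
  (\int[P]_w (quad e w)%:E = (s2 ^+ 2 * 2)%:E * \int[P]_w (trV e w)%:E)%E.
Proof.
move=> e0.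
have iX2 k : P.-integrable setT (fun w => (X (inr k) w ^+ 2)%:E).
  apply: (@integrable_coord _ _ _ _ _ _ _ _ s2_neq0 (@lawx k) (fun t => t ^+ 2) 1) => [|t].
    exact: measurable_funX.
  by rewrite ger0_norm ?sqr_ge0 // mul1r lerDr.
have mf k : measurable_fun setT (fun w => fx e k (Xw w)).
  exact: (coord_measurable_fx e k mX).
have mf' k : measurable_fun setT (fun w => dfx e k (Xw w)).
  exact: (coord_measurable_dfx e0 k mX).
pose A := L%:R * e^-1 ^+ 2.
have i1 k : P.-integrable setT (fun w => (X (inr k) w * fx e k (Xw w))%:E).
  (* As [fx] is unbounded, the product is dominated through [|a b| <= a^2 + b^2], and [sqr_fx_le]
     bounds [b^2] by squares of coordinates of [x], which are integrable. *)
  apply: (@le_integrable _ _ _ P setT measurableT _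
     (fun w => (X (inr k) w ^+ 2)%:E + A%:E * \sum_l (X (inr l) w ^+ 2)%:E)%E).
  - by apply/measurable_EFinP; exact: measurable_funM.
  - move=> w _; rewrite sumEFin lee_fin; apply: le_trans (ler_norm _).
    apply: (@le_trans _ _ (X (inr k) w ^+ 2 + fx e k (Xw w) ^+ 2)).
      set a := X _ w; set b := fx _ _ _.
      by rewrite ler_norml; have := sqr_ge0 (a + b); have := sqr_ge0 (a - b); nra.
    by rewrite lerD2l; exact: sqr_fx_le.
  - apply: integrableD => //; apply: integrableZl => //.
    by apply: integrable_sum => // l _; exact: iX2.
have i2 k : P.-integrable setT (fun w => (dfx e k (Xw w))%:E).
  by apply: (@integrable_bounded _ _ _ P _ (e^-1)) => // w; exact: abs_dfx_le.
have := stein_sum indX s2_neq0 lawx (coord_measurable_fx e) (coord_measurable_dfx e0)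
  (is_derive_fx e0) (@continuous_dfx R L N e) (fx_growth e0) i1 i2.
under eq_integral do rewrite sum_fx //.
under [X in (_ = _ * X)%E]eq_integral do rewrite sum_dfx // EFinM.
by rewrite integralZl ?muleA //; exact: integrable_trV.
Qed.

(** The bound on the second moment; the halves in the two coordinate variances cancel in the
    quotient. *)
Let c0 : R := L%:R / (N%:R - L%:R) * (s2 ^+ 2 / s1 ^+ 2).

Lemma integral_quad_le e : 0 < e -> (\int[P]_w (quad e w)%:E <= c0%:E)%E.
Proof.
move=> e0; rewrite integral_quad //.
have s20 : 0 < s2 ^+ 2 by rewrite exprn_even_gt0.
have NL : 0 < N%:R - L%:R :> R by rewrite subr_gt0 ltr_nat.
apply: le_trans (lee_wpmul2l _ (integral_trV_le e0)) _.
  by rewrite lee_fin mulr_ge0 // ltW.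
rewrite -EFinM lee_fin le_eqVlt; apply/orP; left; apply/eqP; rewrite /c0; field.
by rewrite s1_neq0 gt_eqF.
Qed.

Let sing : set T := [set w | Gof (Xw w) *m ctrmx (Gof (Xw w)) \notin unitmx].

Lemma measurable_gram_unit :
  measurable_fun setT (fun w => Gof (Xw w) *m ctrmx (Gof (Xw w)) \in unitmx).
Proof.
apply: measurable_unitmx; apply: mxmeasM (mxmeas_ctrmx _); exact: (mxmeas_Gof mX).
Qed.

Lemma measurable_sing : measurable sing.
Proof.
have := @measurable_gram_unit measurableT [set false] Logic.I.
by rewrite setTI; congr measurable; apply/seteqP; split=> w /=;
  [by rewrite /sing /= => ->|exact: negbTE].
Qed.

(** A Markov estimate: on [sing] one has [1 <= e L tr V], and [E (tr V)] is at most [M] for every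
    [e]. So [P sing <= e L M] with [e] arbitrarily small. *)
Lemma probability_sing : P sing = 0%E.
Proof.
have NL : 0 < N%:R - L%:R :> R by rewrite subr_gt0 ltr_nat.
pose M : R := L%:R / (s1 ^+ 2 * 2 * (N%:R - L%:R)).
have M0 : 0 <= M.
  by rewrite divr_ge0 // mulr_ge0 ?(ltW NL) // mulr_ge0 ?sqr_ge0.
have H e : 0 < e -> (P sing <= (e * (L%:R * M))%:E)%E.
  move=> e0.
  have -> : P sing = (\int[P]_w (\1_sing w)%:E)%E.
    by rewrite integral_indic ?setIT //; exact: measurable_sing.
  apply: (@le_trans _ _ (\int[P]_w ((e * L%:R)%:E * (trV e w)%:E))%E).
    apply: ge0_le_integral => //.
    - exact/measurable_EFinP/measurable_indic/measurable_sing.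
    - by apply/measurable_EFinP; apply: measurable_funM => //; exact: measurable_trV.
    - move=> w _; rewrite -EFinM lee_fin indicE; case: (boolP (w \in sing)) => [|_] /=.
        rewrite inE => /(resolvent_diag_singular e0) He.
        by rewrite -mulrA -ler_pdivrMl // mulr1.
      by rewrite mulr_ge0 ?trV_ge0 // mulr_ge0 // ltW.
  rewrite integralZl //; last exact: integrable_trV.
  rewrite mulrA [X in (_ <= X)%E]EFinM; apply: lee_wpmul2l; last exact: integral_trV_le.
  by rewrite lee_fin mulr_ge0 // ltW.
have LM0 : 0 <= L%:R * M by rewrite mulr_ge0.
apply/eqP; rewrite eq_le measure_ge0 andbT; apply/lee_addgt0Pr => r r0; rewrite add0e.
(* The added 1 keeps the denominator positive, as [L%:R * M] is only known to be nonnegative. *)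
have e0 : 0 < r / (L%:R * M + 1) by rewrite divr_gt0 // ltr_wpDl.
apply: le_trans (H _ e0) _; rewrite lee_fin -mulrA ler_piMr ?(ltW r0) //.
by rewrite ler_pdivrMl ?ltr_wpDl // mulr1 lerDl.
Qed.

Let pnorm w : R := cvnorm (moore_pinv (Gof (Xw w)) *m xof (Xw w)).

Lemma measurable_pnorm : measurable_fun setT pnorm.
Proof.
apply: measurable_cvnorm; apply: mxmeasM (mxmeas_xof mX).
have mG := mxmeas_Gof mX; have mGc := mxmeas_ctrmx mG.
exact: mxmeasM mGc (mxmeas_invmx (mxmeasM mG mGc)).
Qed.

(** With [e = harmonic n], [sqr_pinv_le] bounds the quadratic form below by a sequence converging to
    [pnorm w ^+ 2]. A lower bound is enough for Fatou's lemma, so the limit of the form itself is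
    not computed. *)
Lemma pnorm_le_limn_einf w : ~ sing w ->
  ((pnorm w ^+ 2)%:E <= limn_einf (fun n => (quad (harmonic n) w)%:E))%E.
Proof.
move=> /negP; rewrite negbK => uS.
pose y := cvnorm (invmx (Gof (Xw w) *m ctrmx (Gof (Xw w))) *m xof (Xw w)) ^+ 2.
have cv : (pnorm w ^+ 2 - harmonic n * y)%:E @[n --> \oo] --> (pnorm w ^+ 2)%:E.
  apply: cvg_EFin; first exact: nearW.
  rewrite -[X in _ --> X]subr0 -[X in _ - X](mul0r y).
  apply: cvgB; first exact: cvg_cst.
  by apply: cvgM; [exact: cvg_harmonic|exact: cvg_cst].
rewrite -(cvg_limn_einf_sup cv).1; apply: le_limn_einf => n.
rewrite lee_fin lerBlDr; apply: sqr_pinv_le uS.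
by rewrite /harmonic /= invr_gt0.
Qed.

Lemma integral_sqr_pnorm_le : (\int[P]_w (pnorm w ^+ 2)%:E <= c0%:E)%E.
Proof.
have h0 n : 0 < harmonic n :> R by rewrite /harmonic /= invr_gt0.
have mq n : measurable_fun setT (fun w => (quad (harmonic n) w)%:E).
  by apply/measurable_EFinP; exact: measurable_quad.
have q0 n w : [set: T] w -> (0 <= (quad (harmonic n) w)%:E)%E.
  by move=> _; rewrite lee_fin; exact: quad_resolvent_ge0.
apply: (@le_trans _ _ (\int[P]_w limn_einf (fun n => (quad (harmonic n) w)%:E))%E).
  apply: ae_ge0_le_integral => //.
  - by move=> w _; rewrite lee_fin sqr_ge0.
  - by apply/measurable_EFinP; apply: measurable_funX; exact: measurable_pnorm.
  - move=> w _; rewrite -[X in (X <= _)%E](cvg_limn_einf_sup (cvg_cst 0%E)).1.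
    by apply: le_limn_einf => n; exact: q0.
  - apply: measurableT_comp => //.
    (* The lower limit is the opposite of the upper limit of the opposites, and measurability is
       obtained for the latter. *)
    apply: (measurable_fun_limn_esup (f := fun n w => - (quad (harmonic n) w)%:E)%E) => n.
    by apply: measurableT_comp => //; exact: mq.
  (* On [sing] the inverse in the pseudo-inverse is a mere default value; the pointwise bound is
     claimed only off this null set. *)
  - exists sing; split; [exact: measurable_sing|exact: probability_sing|].
    move=> w /= H; apply: contrapT => /pnorm_le_limn_einf Hw; exact: H.
apply: le_trans (fatou _ measurableT mq q0) _.
rewrite -[X in (_ <= X)%E](cvg_limn_einf_sup (cvg_cst c0%:E)).1.
by apply: le_limn_einf => n; exact: integral_quad_le.
Qed.

(* AM-GM: [h <= c / 2 + h ^+ 2 / (2 c)] *)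
Lemma integral_pnorm_le (c : R) : 0 < c -> c0 <= c ^+ 2 ->
  (\int[P]_w (pnorm w)%:E <= c%:E)%E.
Proof.
move=> c_gt0 c0c; have mh := measurable_pnorm.
have mh2 : measurable_fun setT (fun w => (pnorm w ^+ 2)%:E).
  by apply/measurable_EFinP; exact: measurable_funX.
have c20 : 0 <= (2 * c)^-1 by rewrite invr_ge0 mulr_ge0 // ltW.
apply: (@le_trans _ _ (\int[P]_w ((c / 2)%:E + ((2 * c)^-1)%:E * (pnorm w ^+ 2)%:E))%E).
  apply: ge0_le_integral => //.
  - by move=> w _; rewrite lee_fin sqrtr_ge0.
  - exact/measurable_EFinP.
  - apply/measurable_EFinP; apply: measurable_funD => //; apply: measurable_funM => //.
    exact: measurable_funX.
  - move=> w _; rewrite -EFinM -EFinD lee_fin.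
    rewrite -(ler_pM2l (_ : 0 < 2 * c)) ?mulr_gt0 // mulrDr mulrA divff ?mul1r; last first.
      by rewrite gt_eqF // mulr_gt0.
    by have := sqr_ge0 (c - pnorm w); nra.
rewrite ge0_integralD //; last 3 first.
- by move=> w _; rewrite lee_fin divr_ge0 // ltW.
- by move=> w _; rewrite -EFinM lee_fin mulr_ge0 // sqr_ge0.
- exact: emeasurable_funM.
rewrite integral_cst //= probability_setT mule1 ge0_integralZl //; last first.
  by move=> w _; rewrite lee_fin sqr_ge0.
apply: (@le_trans _ _ ((c / 2)%:E + ((2 * c)^-1)%:E * (c ^+ 2)%:E)%E).
  apply: leeD2l; apply: lee_wpmul2l; first by rewrite lee_fin.
  by apply: le_trans integral_sqr_pnorm_le _; rewrite lee_fin.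
rewrite -EFinM -EFinD lee_fin le_eqVlt; apply/orP; left; apply/eqP; field.
by rewrite gt_eqF.
Qed.

End PseudoInverse.

Unset Implicit Arguments.

Theorem theorem4 (R : realType) (L N : nat) (d : measure_display)
    (T : measurableType d) (P : probability T R) (sigma1 sigma2 : R)
    (X : coord_idx L N -> {RV P >-> R}) :
  (0 < L)%N -> (L.+1 < N)%N -> 0 < sigma1 -> 0 < sigma2 ->
  mutually_independent X ->
  (forall i j b A, measurable A ->
     distribution P (X (inl (i, j, b))) A = normal_prob 0 (sigma1 / Num.sqrt 2) A) ->
  (forall i b A, measurable A ->
     distribution P (X (inr (i, b))) A = normal_prob 0 (sigma2 / Num.sqrt 2) A) ->
  (\int[P]_w (cvnorm (moore_pinv (Gmat X w) *m xvec X w))%:E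
     <= (Num.sqrt (L%:R / (N - L - 1)%:R) * (sigma2 / sigma1))%:E)%E.
Proof.
move=> L0 LN s10 s20 indX lawG lawx.
have NL : (L < N)%N by exact: ltn_trans LN.
have r2 : 0 < Num.sqrt 2 :> R by rewrite sqrtr_gt0.
(* Subtraction of naturals is truncated; it is exact here because [L < N]. *)
have D1 : (N - L - 1)%:R = N%:R - L%:R - 1 :> R.
  by rewrite natrB ?subn_gt0 // natrB // ltnW.
have D0 : 0 < N%:R - L%:R - 1 :> R.
  by rewrite -D1 ltr0n subn_gt0 ltn_subRL addn1.
have q0 : 0 < L%:R / (N - L - 1)%:R :> R by rewrite D1 divr_gt0 // ltr0n.
(* A circularly symmetric entry of variance [sigma^2] has real and imaginary parts of variance
   [sigma^2 / 2], hence the standard deviations [sigma / sqrt 2]. *)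
apply: (@integral_pnorm_le R L N d T P X (sigma1 / Num.sqrt 2) (sigma2 / Num.sqrt 2)) => //.
- by rewrite gt_eqF // divr_gt0.
- by rewrite gt_eqF // divr_gt0.
- by move=> [[i j] b]; exact: lawG.
- by move=> [i b]; exact: lawx.
- by rewrite mulr_gt0 ?sqrtr_gt0 // divr_gt0.
rewrite [X in _ <= X]exprMn sqr_sqrtr ?(ltW q0) // D1.
have -> : (sigma2 / Num.sqrt 2) ^+ 2 / (sigma1 / Num.sqrt 2) ^+ 2 = (sigma2 / sigma1) ^+ 2.
  by field; rewrite !gt_eqF.
(* What remains is the comparison of [L / (N - L)] with the larger [L / (N - L - 1)]. *)
rewrite ler_wpM2r ?sqr_ge0 // ler_wpM2l // lef_pV2 ?posrE //.
  by rewrite gerBl.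
by rewrite subr_gt0 ltr_nat.
Qed.
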